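(* Let $\mathcal{H}=\bigoplus_{n\ge0}\mathcal{H}_n$ and $\bar{\mathcal{H}}=\bigoplus_{n\ge0}\bar{\mathcal{H}}_n$ be graded connected Hopf algebras with graded bases $\mathcal{B}=\coprod_n\mathcal{B}_n$ and $\bar{\mathcal{B}}=\coprod_n\bar{\mathcal{B}}_n$ respectively, and suppose $\mathcal{B}$ is a state space basis. Let $\Psi=\sum_D\alpha_D\,\mathrm{Proj}_{d_1}*\dots*\mathrm{Proj}_{d_a}$ be a non-negative convolution of projections on $\mathcal{H}_n$ (the same formula, with the same coefficients $\alpha_D$, defines the corresponding operator on $\bar{\mathcal{H}}$). If $\theta:\mathcal{H}\to\bar{\mathcal{H}}$ is a morphism of Hopf algebras such that $\theta(\mathcal{B}_n)=\bar{\mathcal{B}}_n$ for all $n$, then the $\Psi$-Markov chain on $\bar{\mathcal{B}}_n$ is the projection under $\theta$ of the $\Psi$-Markov chain on $\mathcal{B}_n$: that is, for any starting state, if $(X_t)$ is the $\Psi$-Markov chain on $\mathcal{B}_n$, then $(\theta(X_t))$ is a Markov chain whose transition probabilities are those of the $\Psi$-Markov chain on $\bar{\mathcal{B}}_n$.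
   Context: The ground field is $\mathbb{Q}$ or $\mathbb{R}$. A graded Hopf algebra $\mathcal{H}=\bigoplus_{n\ge0}\mathcal{H}_n$ is connected if $\dim\mathcal{H}_0=1$; each $\mathcal{H}_n$ is finite-dimensional. A basis $\mathcal{B}=\coprod_n\mathcal{B}_n$ ($\mathcal{B}_n$ a basis of $\mathcal{H}_n$) is a state space basis if: (i) for all $w,z\in\mathcal{B}$, $m(w\otimes z)$ has non-negative coefficients in $\mathcal{B}$; (ii) for all $x\in\mathcal{B}$, $\Delta(x)$ has non-negative coefficients in $\mathcal{B}\otimes\mathcal{B}$; (iii) for $n>1$, no $x\in\mathcal{B}_n$ is primitive, i.e. $\Delta(x)\ne1\otimes x+x\otimes1$. For linear maps $f,g:\mathcal{H}\to\mathcal{H}$, the convolution is $f*g:=m(f\otimes g)\Delta$ (associative). $\mathrm{Proj}_d:\mathcal{H}\to\mathcal{H}$ is the projection onto $\mathcal{H}_d$ (identity on $\mathcal{H}_d$, zero on $\mathcal{H}_i$ for $i\neq d$; $d=0$ allowed). Iterated maps: $m^{[1]}=\iota$ (identity), $m^{[a]}=m(m^{[a-1]}\otimes\iota)$; $\Delta^{[1]}=\iota$, $\Delta^{[a]}=(\iota\otimes\dots\otimes\iota\otimes\Delta)\Delta^{[a-1]}$. Fix $a\ge2$. A non-negative convolution of projections on $\mathcal{H}_n$ is a map $\Psi=\sum_{D}\alpha_D\,\mathrm{Proj}_{d_1}*\dots*\mathrm{Proj}_{d_a}$, sum over weak compositions $D=(d_1,\dots,d_a)$ ($d_i\ge0$),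 such that $\alpha_D\ge0$ for all weak compositions $D$ of $n$, and $\alpha_D>0$ for some weak composition $D$ of $n$ with every $d_i\ne n$. For $x\in\mathcal{B}_n$, let $\eta(x)$ be the sum of the coefficients, in the basis $\mathcal{B}^{\otimes n}$, of $\mathrm{Proj}_1^{\otimes n}\Delta^{[n]}(x)$ (nonzero for a state space basis). Let $\beta_n:=\sum_{d_1+\dots+d_a=n}\alpha_D\binom{n}{d_1\,\dots\,d_a}$. The $\Psi$-Markov chain on $\mathcal{B}_n$ has state space $\mathcal{B}_n$ and transition probabilities $K(x,y)=\frac{\eta(y)}{\eta(x)\beta_n}\cdot[\text{coefficient of }y\text{ in }\Psi(x)]$; equivalently its transition matrix is the transpose of the matrix of $\frac{1}{\beta_n}\Psi$ with respect to the basis $\{x/\eta(x):x\in\mathcal{B}_n\}$. The $\Psi$-Markov chain on $\bar{\mathcal{B}}_n$ is defined by the same formula with $\bar{\mathcal{H}},\bar{\mathcal{B}}$ in place of $\mathcal{H},\mathcal{B}$. *)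

(* Defs.v *)
From HB Require Import structures.
From mathcomp Require Import all_boot all_order all_algebra finmap.
From mathcomp Require Import generic_quotient sesquilinear.
From mathcomp Require Import all_classical all_reals all_analysis.

Set Implicit Arguments.
Unset Strict Implicit.
Unset Printing Implicit Defensive.

Import Order.TTheory GRing.Theory Num.Theory.

Local Open Scope classical_set_scope.
Local Open Scope quotient_scope.
Local Open Scope ring_scope.

(* Tensor products.  An element of U (x) V is a formal sum of pure tensors,   *)
(* i.e. a sequence of pairs (scalars are absorbed in the left factor); two    *)
(* formal sums are identified when no bilinear map separates them.            *)

Notation is_bilinear f := (bilinear_for *:%R *:%R f).

Section Tensor.
Context (K : comNzRingType) (U V : lmodType K).
Implicit Types s t : seq (U * V).

Definition fsum (W : zmodType) (f : U -> V -> W) s : W :=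
  \sum_(p <- s) f p.1 p.2.

Definition tens_eqv s t : bool :=
  `[< forall (W : lmodType K) (f : U -> V -> W), is_bilinear f ->
        fsum f s = fsum f t >].

Lemma tens_eqvP s t :
  reflect (forall (W : lmodType K) (f : U -> V -> W), is_bilinear f ->
             fsum f s = fsum f t)
          (tens_eqv s t).
Proof. exact: asboolP. Qed.

Lemma tens_eqv_refl : reflexive tens_eqv.
Proof. by move=> s; apply/tens_eqvP. Qed.

Lemma tens_eqv_sym : symmetric tens_eqv.
Proof.
by move=> s t; apply/tens_eqvP/tens_eqvP => h W f bf; rewrite h.
Qed.

Lemma tens_eqv_trans : transitive tens_eqv.
Proof.
move=> t s r /tens_eqvP st /tens_eqvP tr; apply/tens_eqvP => W f bf.
by rewrite st ?tr.
Qed.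

Canonical tens_equiv :=
  EquivRel tens_eqv tens_eqv_refl tens_eqv_sym tens_eqv_trans.

Definition tensor := {eq_quot tens_eqv}.

HB.instance Definition _ := Choice.on tensor.
HB.instance Definition _ := EqQuotient.on tensor.

Lemma tens_piP s t :
  reflect (forall (W : lmodType K) (f : U -> V -> W), is_bilinear f ->
             fsum f s = fsum f t)
          (\pi_tensor s == \pi_tensor t).
Proof. by rewrite eqmodE; exact: tens_eqvP. Qed.

Lemma fsum_repr (W : lmodType K) (f : U -> V -> W) s :
  is_bilinear f -> fsum f (repr (\pi_tensor s)) = fsum f s.
Proof. by move=> bf; apply/tens_piP => //; rewrite reprK. Qed.

Lemma tens_reprP (x y : tensor) :
  (forall (W : lmodType K) (f : U -> V -> W), is_bilinear f ->
     fsum f (repr x) = fsum f (repr y)) -> x = y.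
Proof. by move=> h; rewrite -[x]reprK -[y]reprK; apply/eqP/tens_piP. Qed.

Lemma fsum_cat (W : zmodType) (f : U -> V -> W) s t :
  fsum f (s ++ t) = fsum f s + fsum f t.
Proof. by rewrite /fsum big_cat. Qed.

Lemma fsum_scale (W : lmodType K) (f : U -> V -> W) a s : is_bilinear f ->
  fsum f [seq (a *: p.1, p.2) | p <- s] = a *: fsum f s.
Proof.
move=> [bf _]; rewrite /fsum big_map scaler_sumr; apply: eq_bigr => p _ /=.
exact: (scalable_linear (bf p.2)).
Qed.

Definition tens_zero : tensor := \pi_tensor [::].
Definition tens_add (x y : tensor) : tensor := \pi_tensor (repr x ++ repr y).
Definition tens_scale (a : K) (x : tensor) : tensor :=
  \pi_tensor [seq (a *: p.1, p.2) | p <- repr x].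
Definition tens_opp : tensor -> tensor := tens_scale (- 1).

Lemma fsum0 (W : lmodType K) (f : U -> V -> W) :
  is_bilinear f -> fsum f (repr tens_zero) = 0.
Proof. by move=> bf; rewrite fsum_repr// /fsum big_nil. Qed.

Lemma fsumD (W : lmodType K) (f : U -> V -> W) x y : is_bilinear f ->
  fsum f (repr (tens_add x y)) = fsum f (repr x) + fsum f (repr y).
Proof. by move=> bf; rewrite fsum_repr// fsum_cat. Qed.

Lemma fsumZ (W : lmodType K) (f : U -> V -> W) a x : is_bilinear f ->
  fsum f (repr (tens_scale a x)) = a *: fsum f (repr x).
Proof. by move=> bf; rewrite fsum_repr// fsum_scale. Qed.

Lemma tens_addA : associative tens_add.
Proof. by move=> x y z; apply: tens_reprP => W f bf; rewrite !fsumD// addrA. Qed.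

Lemma tens_addC : commutative tens_add.
Proof. by move=> x y; apply: tens_reprP => W f bf; rewrite !fsumD// addrC. Qed.

Lemma tens_add0 : left_id tens_zero tens_add.
Proof. by move=> x; apply: tens_reprP => W f bf; rewrite fsumD// fsum0// add0r. Qed.

Lemma tens_addN : left_inverse tens_zero tens_opp tens_add.
Proof.
move=> x; apply: tens_reprP => W f bf.
by rewrite fsumD// fsumZ// fsum0// scaleN1r addNr.
Qed.

HB.instance Definition _ :=
  GRing.isZmodule.Build tensor tens_addA tens_addC tens_add0 tens_addN.

Lemma tens_scaleA a b x : tens_scale a (tens_scale b x) = tens_scale (a * b) x.
Proof. by apply: tens_reprP => W f bf; rewrite !fsumZ// scalerA. Qed.

Lemma tens_scale1 : left_id 1 tens_scale.
Proof. by move=> x; apply: tens_reprP => W f bf; rewrite !fsumZ// scale1r. Qed.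

Lemma tens_scaleDr : right_distributive tens_scale +%R.
Proof.
by move=> a x y; apply: tens_reprP => W f bf; rewrite fsumZ// !fsumD// !fsumZ// scalerDr.
Qed.

Lemma tens_scaleDl x : {morph tens_scale^~ x : a b / a + b}.
Proof.
by move=> a b; apply: tens_reprP => W f bf; rewrite fsumD// !fsumZ// scalerDl.
Qed.

HB.instance Definition _ := GRing.Zmodule_isLmodule.Build K tensor
  tens_scaleA tens_scale1 tens_scaleDr tens_scaleDl.

Definition tens (u : U) (v : V) : tensor := \pi_tensor [:: (u, v)].

(* The map out of U (x) V induced by f; independent of the representative,    *)
(* and linear, as soon as f is bilinear.                                      *)
Definition tlift (W : zmodType) (f : U -> V -> W) (x : tensor) : W :=
  fsum f (repr x).

Lemma tlift_tens (W : lmodType K) (f : U -> V -> W) u v :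
  is_bilinear f -> tlift f (tens u v) = f u v.
Proof. by move=> bf; rewrite /tlift fsum_repr// /fsum big_seq1. Qed.

Lemma tlift_linear (W : lmodType K) (f : U -> V -> W) :
  is_bilinear f -> linear (tlift f).
Proof. by move=> bf a x y; rewrite /tlift fsumD// fsumZ. Qed.

Lemma tens_bilinear : is_bilinear tens.
Proof.
split=> [v a u u'|u a v v']; apply: tens_reprP => W f bf;
  rewrite fsumD// fsumZ// !fsum_repr// /fsum !big_seq1 /=.
  by rewrite bf.1.
by rewrite bf.2.
Qed.

Lemma tensor_sum (x : tensor) : x = \sum_(p <- repr x) tens p.1 p.2.
Proof.
apply: tens_reprP => W f bf.
elim: (repr x) => [|[u v] s IHs].
  by rewrite big_nil /fsum big_nil; have := fsum0 bf; rewrite /fsum => ->.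
rewrite big_cons fsumD// -IHs /= fsum_repr// /fsum big_cons big_seq1.
by [].
Qed.

Lemma tlift_unique (W : lmodType K) (f : U -> V -> W) (g : tensor -> W) :
  is_bilinear f -> linear g -> (forall u v, g (tens u v) = f u v) ->
  g =1 tlift f.
Proof.
move=> bf lg gf x; rewrite /tlift.
have gD : {morph g : y z / y + z}.
  by move=> y z; have := lg 1 y z; rewrite !scale1r.
have g0 : g 0 = 0 by apply: (addIr (g 0)); rewrite -gD !add0r.
rewrite {1}[x]tensor_sum (big_morph g gD g0); apply: eq_bigr => p _.
exact: gf.
Qed.

End Tensor.

Definition tmap (K : comNzRingType) (U V U' V' : lmodType K)
    (f : U -> U') (g : V -> V') : tensor U V -> tensor U' V' :=
  tlift (fun u v => tens (f u) (g v)).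

Definition tassoc (K : comNzRingType) (U V W : lmodType K) :
    tensor (tensor U V) W -> tensor U (tensor V W) :=
  tlift (fun x w => tlift (fun u v => tens u (tens v w)) x).

(* The multiplication m : A (x) A -> A of an algebra, and the product of the  *)
(* algebra A (x) A.                                                           *)
Definition mulmap (K : comNzRingType) (A : algType K) : tensor A A -> A :=
  tlift (fun a b => a * b).

Definition tens_mul (K : comNzRingType) (A : algType K) (x y : tensor A A) :
    tensor A A :=
  tlift (fun a b => tlift (fun a' b' => tens (a * a') (b * b')) y) x.

(* tpow V n is the (n+1)-st tensor power V (x) (V (x) ( ... (x) V)).          *)
Fixpoint tpow (K : comNzRingType) (V : lmodType K) (n : nat) : lmodType K :=
  if n is n'.+1 then tensor V (tpow V n') else V.

Fixpoint tpow_map (K : comNzRingType) (V : lmodType K) (f : V -> V) (n : nat) :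
    tpow V n -> tpow V n :=
  match n with
  | 0 => f
  | n'.+1 => tmap f (tpow_map f (n := n'))
  end.

Definition tens_set (K : comNzRingType) (U V : lmodType K)
    (B : set U) (C : set V) : set (tensor U V) :=
  [set x | exists b c, [/\ B b, C c & x = tens b c]].

Fixpoint tpow_set (K : comNzRingType) (V : lmodType K) (B : set V) (n : nat) :
    set (tpow V n) :=
  match n return set (tpow V n) with
  | 0 => B
  | n'.+1 => tens_set B (@tpow_set K V B n')
  end.
Arguments tpow_set {K V} B n _.

Section Bases.
Context (K : fieldType) (V : lmodType K).
Implicit Types (B W : set V) (c : {fsfun V -> K with 0}).

Definition lincomb c : V := \sum_(b <- finsupp c) c b *: b.

Definition expands B c (x : V) : Prop :=
  [set` finsupp c] `<=` B /\ x = lincomb c.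

(* B is a basis of the subspace W. *)
Definition is_basis B W : Prop :=
  B `<=` W /\ forall x, W x -> exists! c, expands B c x.

Definition has_dim W (d : nat) : Prop :=
  exists2 B : {fset V}, #|` B| = d & is_basis [set` B] W.

(* Coordinates in a basis B (the zero family if x has no expansion in B). *)
Definition coords B (x : V) : {fsfun V -> K with 0} :=
  xget [fsfun]%fset [set c | expands B c x].

Definition coef B (x b : V) : K := coords B x b.

Definition sum_coef B (x : V) : K :=
  \sum_(b <- finsupp (coords B x)) coords B x b.

End Bases.

(* A decomposition of V as the direct sum of the subspaces piece n, with its  *)
(* projections; that the pieces are subspaces, that their sum is direct and   *)
(* that proj is unique all follow from the four conditions.                   *)
Record grading (K : fieldType) (V : lmodType K) := Grading {
  piece : nat -> set V;
  proj : nat -> {linear V -> V};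
  proj_piece : forall n x, piece n (proj n x);
  proj_id : forall n x, piece n x -> proj n x = x;
  proj_off : forall i n x, i <> n -> piece i x -> proj n x = 0;
  sum_proj : forall x, exists N, x = \sum_(i < N) proj i x }.

Section Hopf.
Context (K : fieldType) (H : algType K).

Definition conv (D : H -> tensor H H) (f g : H -> H) : H -> H :=
  fun x => mulmap (tmap f g (D x)).

Record hopf_struct := HopfStruct {
  comul : {linear H -> tensor H H};
  counit : {scalar H};
  antipode : {linear H -> H};
  comulA : forall x,
    tassoc (tmap comul id (comul x)) = tmap id comul (comul x);
  counitl : forall x, tlift (fun a b => counit a *: b) (comul x) = x;
  counitr : forall x, tlift (fun a b => counit b *: a) (comul x) = x;
  comul1 : comul 1 = tens 1 1;
  comulM : forall x y, comul (x * y) = tens_mul (comul x) (comul y);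
  counit1 : counit 1 = 1;
  counitM : forall x y, counit (x * y) = counit x * counit y;
  antipodel : forall x, conv comul antipode id x = counit x *: 1;
  antipoder : forall x, conv comul id antipode x = counit x *: 1 }.

Record graded_connected_hopf := GradedConnectedHopf {
  hopf :> hopf_struct;
  grade :> grading H;
  piece1 : piece grade 0 1;
  pieceM : forall i j x y,
    piece grade i x -> piece grade j y -> piece grade (i + j)%N (x * y);
  piece_comul : forall n x, piece grade n x ->
    exists2 s : seq (H * H),
      forall p, p \in s -> exists i j,
        [/\ (i + j)%N = n, piece grade i p.1 & piece grade j p.2]
      & comul hopf x = \sum_(p <- s) tens p.1 p.2;
  piece_counit : forall n x, (0 < n)%N -> piece grade n x -> counit hopf x = 0;
  piece_antipode : forall n x,
    piece grade n x -> piece grade n (antipode hopf x);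
  piece_findim : forall n, exists d, has_dim (piece grade n) d;
  piece_connected : has_dim (piece grade 0) 1 }.

End Hopf.

Definition hopf_morphism (K : fieldType) (H H' : algType K)
    (hH : hopf_struct H) (hH' : hopf_struct H')
    (theta : {lrmorphism H -> H'}) : Prop :=
  (forall x, comul hH' (theta x) = tmap theta theta (comul hH x)) /\
  (forall x, counit hH' (theta x) = counit hH x).

Section Chains.
Context (K : fieldType) (H : algType K) (hH : graded_connected_hopf H).
Implicit Types (B : nat -> {fset H}).

Definition graded_basis B : Prop :=
  forall n, is_basis [set` B n] (piece hH n).

Definition total_basis B : set H := \bigcup_n [set` B n].

Fixpoint convs (f : H -> H) (s : seq (H -> H)) : H -> H :=
  if s is g :: s' then conv (comul hH) f (convs g s') else f.

(* Proj_{d_1} * ... * Proj_{d_a}; the value on the empty list is irrelevant. *)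
Definition conv_proj (D : seq nat) : H -> H :=
  if [seq (proj hH d : H -> H) | d <- D] is f :: s then convs f s else id.

(* id (x) ... (x) id (x) comul, from the (n+1)-st to the (n+2)-nd power. *)
Fixpoint comul_last (n : nat) : tpow H n -> tpow H n.+1 :=
  match n with
  | 0 => comul hH
  | n'.+1 => tmap id (comul_last (n := n'))
  end.

(* icomul n is the iterated coproduct with n+1 tensor factors. *)
Fixpoint icomul (n : nat) : H -> tpow H n :=
  match n with
  | 0 => id
  | n'.+1 => fun x => comul_last (icomul n' x)
  end.

(* Meant for x in B n with n > 0: there are then n tensor factors. *)
Definition eta B (n : nat) (x : H) : K :=
  sum_coef (tpow_set (total_basis B) n.-1)
    (tpow_map (proj hH 1) (icomul n.-1 x)).

End Chains.

Section Operators.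
Context (n a : nat).

(* Weak compositions of n with a parts; all parts are at most n, so a tuple   *)
(* over 'I_n.+1 can encode each of them. On the degree n part, the terms of   *)
(* Psi indexed by weak compositions of other integers vanish.                 *)
Definition weak_comp (D : a.-tuple 'I_n.+1) : bool :=
  (\sum_(d <- D) (d : nat) == n)%N.

Definition multinomial (D : a.-tuple 'I_n.+1) : nat :=
  (n`! %/ \prod_(d <- D) (d : nat)`!)%N.

Definition nonneg_coeffs (K : realFieldType) (alpha : a.-tuple 'I_n.+1 -> K) :
    Prop :=
  (forall D, weak_comp D -> 0 <= alpha D) /\
  exists D, [/\ weak_comp D, (forall d, d \in D -> (d : nat) <> n)
              & 0 < alpha D].

Context (K : fieldType) (alpha : a.-tuple 'I_n.+1 -> K).

Definition beta : K := \sum_(D | weak_comp D) alpha D * (multinomial D)%:R.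

Context (H : algType K) (hH : graded_connected_hopf H).

Definition Psi (x : H) : H :=
  \sum_(D | weak_comp D)
    alpha D *: conv_proj hH [seq (d : nat) | d : 'I_n.+1 <- D] x.

Definition trans (B : nat -> {fset H}) (x y : H) : K :=
  eta hH B n y / (eta hH B n x * beta) * coef (total_basis B) (Psi x) y.

End Operators.

Definition state_space_basis (K : realFieldType) (H : algType K)
    (hH : graded_connected_hopf H) (B : nat -> {fset H}) : Prop :=
  let BB := total_basis B in
  [/\ graded_basis hH B,
      forall w z y, BB w -> BB z -> BB y -> 0 <= coef BB (w * z) y,
      forall x w z, BB x -> BB w -> BB z ->
        0 <= coef (tens_set BB BB) (comul hH x) (tens w z)
    & forall n x, (1 < n)%N -> x \in B n ->
        comul hH x <> tens 1 x + tens x 1].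

Section MarkovChain.
Context (R : realType) (S : choiceType).

Definition stochastic (A : {fset S}) (p : S -> S -> R) : Prop :=
  (forall x y, x \in A -> y \in A -> 0 <= p x y) /\
  (forall x, x \in A -> \sum_(y <- A) p x y = 1).

Context (d : measure_display) (T : measurableType d) (P : probability T R).

Definition cond_prob (E F : set T) : R := fine (P (E `&` F)) / fine (P F).

(* (X_t) is a process with values in the finite set A, started at x0, with    *)
(* P(X_{t+1} = s_{t+1} | X_0 = s_0, ..., X_t = s_t) = p s_t s_{t+1}.          *)
Definition markov_chain (A : {fset S}) (p : S -> S -> R) (x0 : S)
    (X : nat -> T -> S) : Prop :=
  [/\ forall t w, X t w \in A,
      forall t x, measurable (X t @^-1` [set x]),
      P (X 0%N @^-1` [set x0]) = 1%E
    & forall t (s : nat -> S), (forall i, s i \in A) ->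
        let past := [set w | forall i, (i <= t)%N -> X i w = s i] in
        P past <> 0%E ->
        cond_prob (X t.+1 @^-1` [set s t.+1]) past = p (s t) (s t.+1)].

End MarkovChain.

(* Main.v *)
(* Let eps1 be the functional "sum of the coefficients of the degree 1 part". *)
(* By coassociativity eta on degree n is the n-th convolution power of eps1.  *)
(* As H is connected, eps1 is an infinitesimal character, so contracting the  *)
(* coproduct with it is a derivation, and Leibniz' rule gives                 *)
(* eta (x y) = binomial (i + j, i) * eta x * eta y for x, y homogeneous of    *)
(* degrees i and j. Hence eta (Psi x) = beta * eta x, i.e. transition         *)
(* probabilities sum to 1, provided eta is nonzero. It is positive on B n by  *)
(* induction on n: as x is not primitive, its coproduct has a term w (x) z    *)
(* with both degrees positive, and eta = eta * eta (convolution).             *)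
(* theta maps a basis to a basis and respects degrees, so it preserves        *)
(* coefficient sums, hence eps1 and eta, and it commutes with Psi; thus the   *)
(* kernel sums over the fibres of theta to the kernel of Hbar, which is the   *)
(* lumping criterion for Markov chains.                                       *)
From Pilot Require Import Defs.
From HB Require Import structures.
From mathcomp Require Import all_boot all_order all_algebra finmap.
From mathcomp Require Import all_classical all_reals all_analysis.

Set Implicit Arguments.
Unset Strict Implicit.
Unset Printing Implicit Defensive.

Import Order.TTheory GRing.Theory Num.Theory.
(* mathcomp-analysis has a [proj] of its own. *)
Import Pilot.Defs.

Local Open Scope classical_set_scope.
Local Open Scope ring_scope.

(** The work is done with [epow n], the counit after n applications of the derivation [der], which
    agrees with [eta] in positive degree n ([etaE]) but involves no tensor powers. It is
    multiplicative up to a binomial coefficient ([epowM]) and turns convolution into addition of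
    exponents ([epowD]). Together these show that following Proj_{d_1} * ... * Proj_{d_a} by
    [epow n] multiplies it by a multinomial coefficient ([epow_conv_proj]). Hence eta is a left
    eigenvector of Psi with eigenvalue beta ([epow_Psi]), which is why rows of the kernel sum to 1
    ([trans_row_sum]); [epow_gt0] and [beta_gt0] make the denominators positive.

    The morphism intertwines the two operators ([theta_Psi]) and preserves eta ([epow_theta]), while
    coefficients add along its fibres ([coef_theta]). This gives the lumping identity [trans_theta].
    The rest is probability: by [markov_chain_lump], a Markov chain whose fibre sums depend only on
    the image of the current state projects to a Markov chain. *)

(** * Linear and bilinear maps on tensor products *)

Section LinearMaps.
Context (K : comNzRingType).
Implicit Types (U V W : lmodType K).

(** Linearity is kept as a proposition about plain functions, since maps such as [tlift h] are
    linear only under a side condition. The map is bundled only inside proofs, to reuse library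
    facts. *)
Lemma lin_sum U V (f : U -> V) : linear f ->
  forall I (r : seq I) (P : pred I) (E : I -> U),
    f (\sum_(i <- r | P i) E i) = \sum_(i <- r | P i) f (E i).
Proof.
move=> lf I r P E.
pose g : {linear U -> V} := HB.pack f (GRing.isLinear.Build K U V *:%R f lf).
exact: (linear_sum g).
Qed.

Lemma lin0 U V (f : U -> V) : linear f -> f 0 = 0.
Proof.
move=> lf; pose g : {linear U -> V} :=
  HB.pack f (GRing.isLinear.Build K U V *:%R f lf).
exact: (linear0 g).
Qed.

Lemma linD U V (f : U -> V) : linear f -> forall x y, f (x + y) = f x + f y.
Proof. by move=> lf x y; have := lf 1 x y; rewrite !scale1r. Qed.

Lemma linZ U V (f : U -> V) : linear f -> forall a x, f (a *: x) = a *: f x.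
Proof. by move=> lf a x; have := lf a x 0; rewrite (lin0 lf) !addr0. Qed.

Lemma lin_id U : linear (@id U).
Proof. by []. Qed.

Lemma lin_comp U V W (f : V -> W) (g : U -> V) :
  linear f -> linear g -> linear (fun x => f (g x)).
Proof. by move=> lf lg a x y; rewrite lg lf. Qed.

Lemma bilin_comp U V U' V' W (h : U' -> V' -> W) (f : U -> U') (g : V -> V') :
  is_bilinear h -> linear f -> linear g ->
  is_bilinear (fun u v => h (f u) (g v)).
Proof.
move=> [h1 h2] lf lg; split=> [v a u u'|u a v v'] /=.
  by rewrite lf h1.
by rewrite lg h2.
Qed.

Lemma comp_bilin U V W W' (f : W -> W') (h : U -> V -> W) :
  linear f -> is_bilinear h -> is_bilinear (fun u v => f (h u v)).
Proof.
move=> lf [h1 h2]; split=> [v a u u'|u a v v'] /=.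
  by rewrite h1 lf.
by rewrite h2 lf.
Qed.

(** With [K^o] for V this is the product of scalars, so that [bilin_comp] makes a product of two
    functionals bilinear. *)
Lemma scale_bilin V : is_bilinear (fun (a : K^o) (v : V) => a *: v).
Proof.
split=> [v a u u'|u a v v'] /=; first by rewrite scalerDl scalerA.
by rewrite scalerDr !scalerA [in LHS]mulrC.
Qed.

Lemma mul_bilin (A : algType K) : is_bilinear (fun a b : A => a * b).
Proof.
split=> [v a u u'|u a v v'] /=; first by rewrite mulrDl scalerAl.
by rewrite mulrDr scalerAr.
Qed.

Lemma tmap_bilin U V U' V' (f : U -> U') (g : V -> V') :
  linear f -> linear g -> is_bilinear (fun u v => tens (f u) (g v)).
Proof. by move=> lf lg; apply: bilin_comp => //; apply: tens_bilinear. Qed.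

Lemma tmap_linear U V U' V' (f : U -> U') (g : V -> V') :
  linear f -> linear g -> linear (tmap f g).
Proof. by move=> lf lg; apply: tlift_linear; apply: tmap_bilin. Qed.

Lemma tmap_tens U V U' V' (f : U -> U') (g : V -> V') u v :
  linear f -> linear g -> tmap f g (tens u v) = tens (f u) (g v).
Proof. by move=> lf lg; rewrite /tmap tlift_tens //; apply: tmap_bilin. Qed.

Lemma tens_ext U V W (F G : tensor U V -> W) : linear F -> linear G ->
  (forall u v, F (tens u v) = G (tens u v)) -> F =1 G.
Proof.
move=> lF lG FG x; rewrite [x]tensor_sum !lin_sum //.
by apply: eq_bigr.
Qed.

Lemma tlift_tmap U V U' V' W (h : U' -> V' -> W) (f : U -> U') (g : V -> V') x :
  is_bilinear h -> linear f -> linear g ->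
  tlift h (tmap f g x) = tlift (fun u v => h (f u) (g v)) x.
Proof.
move=> bh lf lg; move: x; apply: tens_ext.
- by apply: lin_comp; [apply: tlift_linear|apply: tmap_linear].
- by apply: tlift_linear; apply: bilin_comp.
by move=> u v; rewrite tmap_tens // !tlift_tens //; apply: bilin_comp.
Qed.

(** [tlift] sums over a chosen representative; bilinearity allows any other presentation, such as
    the homogeneous one from [piece_comul]. *)
Lemma tlift_pres U V W (h : U -> V -> W) (s : seq (U * V)) :
  is_bilinear h ->
  tlift h (\sum_(p <- s) tens p.1 p.2) = \sum_(p <- s) h p.1 p.2.
Proof.
move=> bh; rewrite lin_sum; last exact: tlift_linear.
by apply: eq_bigr => p _; rewrite tlift_tens.
Qed.

Lemma comp_tlift U V W W' (F : W -> W') (h : U -> V -> W) x :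
  linear F -> F (tlift h x) = tlift (fun u v => F (h u v)) x.
Proof. by move=> lF; rewrite /tlift /fsum lin_sum. Qed.

Lemma eq_tlift U V W (h h' : U -> V -> W) x :
  (forall u v, h u v = h' u v) -> tlift h x = tlift h' x.
Proof. by move=> e; rewrite /tlift /fsum; apply: eq_bigr. Qed.

End LinearMaps.

(** * Coordinates, dual functionals and bases of tensor powers *)

Section BasisTheory.
Context (K : fieldType) (V : lmodType K).
Implicit Types (B W : set V) (c : {fsfun V -> K with 0}).

Lemma lincomb_sub c (S : {fset V}) : (finsupp c `<=` S)%fset ->
  lincomb c = \sum_(b <- S) c b *: b.
Proof.
move=> cS; rewrite /lincomb; apply: big_fset_incl => // x _ xn.
by rewrite fsfun_dflt // scale0r.
Qed.

Lemma expandsP B W x : is_basis B W -> W x -> expands B (coords B x) x.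
Proof.
move=> [_ h] Wx; have [c [ec _]] := h x Wx.
by rewrite /coords; case: xgetP => [c' -> //|/(_ c)].
Qed.

Lemma coords_uniq B W x c : is_basis B W -> W x -> expands B c x ->
  coords B x = c.
Proof.
move=> bB Wx ec; have [_ /(_ x Wx) [c0 [_ u]]] := bB.
by rewrite -(u _ ec) (u _ (expandsP bB Wx)).
Qed.

Lemma coef_notin B W x b : is_basis B W -> W x -> ~ B b -> coef B x b = 0.
Proof.
move=> bB Wx nb; rewrite /coef fsfun_dflt //; apply/negP => bs.
by apply: nb; apply: (expandsP bB Wx).1.
Qed.

Definition lin_closed W := forall a x y, W x -> W y -> W (a *: x + y).

Lemma lin_closedT : lin_closed [set: V].
Proof. by []. Qed.

Lemma coefP B W a x y b : is_basis B W -> lin_closed W -> W x -> W y ->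
  coef B (a *: x + y) b = a * coef B x b + coef B y b.
Proof.
move=> bB sW Wx Wy; have [sx ex] := expandsP bB Wx.
have [sy ey] := expandsP bB Wy.
pose S := (finsupp (coords B x) `|` finsupp (coords B y))%fset.
pose c : {fsfun V -> K with 0} :=
  [fsfun b in S => a * coords B x b + coords B y b].
have cE b' : c b' = a * coords B x b' + coords B y b'.
  rewrite fsfunE; case: ifPn => //; rewrite in_fsetU negb_or => /andP[h1 h2].
  by rewrite !fsfun_dflt // mulr0 addr0.
have cS : (finsupp c `<=` S)%fset by apply: finsupp_sub.
rewrite /coef (@coords_uniq B W _ c) //.
  exact: sW.
split.
  move=> z /= zc; have := fsubsetP cS _ zc; rewrite in_fsetU => /orP[] h.
    exact: sx.
  exact: sy.
rewrite (lincomb_sub cS) {1}ex {1}ey (@lincomb_sub _ S) ?fsubsetUl //.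
rewrite (@lincomb_sub (coords B y) S) ?fsubsetUr // scaler_sumr -big_split.
by apply: eq_bigr => z _ /=; rewrite cE scalerDl scalerA.
Qed.

Lemma coef_basis B W b b' : is_basis B W -> B b ->
  coef B b b' = (b' == b)%:R.
Proof.
move=> bB Bb; have Wb := bB.1 _ Bb.
pose c : {fsfun V -> K with 0} := [fsfun z in [fset b]%fset => 1].
have cS : (finsupp c `<=` [fset b])%fset by apply: finsupp_sub.
rewrite /coef (@coords_uniq B W _ c) //.
  by rewrite fsfunE in_fset1; case: eqP.
split; first by move=> z /= /(fsubsetP cS); rewrite in_fset1 => /eqP ->.
by rewrite (lincomb_sub cS) big_seq_fset1 fsfunE in_fset1 eqxx scale1r.
Qed.

Lemma expand_basis B W x : is_basis B W -> W x ->
  x = \sum_(b <- finsupp (coords B x)) coef B x b *: b.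
Proof. by move=> bB Wx; case: (expandsP bB Wx). Qed.

Lemma coef_linear B b : is_basis B setT ->
  linear (fun x => coef B x b : K^o).
Proof. by move=> bB a x y; rewrite (@coefP _ setT). Qed.

Lemma basis_ext B (U : lmodType K) (f g : V -> U) : is_basis B setT ->
  linear f -> linear g -> {in B, f =1 g} -> f =1 g.
Proof.
move=> bB lf lg e x; rewrite (expand_basis (x := x) bB) // !lin_sum //.
apply: eq_big_seq => b bs; rewrite !linZ // e // inE.
exact: (expandsP bB (x := x) _).1.
Qed.

Lemma sum_coefE B x (S : {fset V}) : (finsupp (coords B x) `<=` S)%fset ->
  sum_coef B x = \sum_(b <- S) coef B x b.
Proof.
move=> cS; rewrite /sum_coef; apply: big_fset_incl => // z _ zn.
by rewrite fsfun_dflt.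
Qed.

Lemma finsupp_coordsP B a x y : is_basis B setT ->
  (finsupp (coords B (a *: x + y)) `<=`
     finsupp (coords B x) `|` finsupp (coords B y))%fset.
Proof.
move=> bB; apply/fsubsetP => z; rewrite in_fsetU !mem_finsupp -negb_and.
apply: contra => /andP[/eqP h1 /eqP h2].
have := @coefP B setT a x y z bB lin_closedT I I.
by rewrite /coef h1 h2 mulr0 addr0 => ->.
Qed.

Lemma sum_coef_linear B : is_basis B setT ->
  linear (sum_coef B : V -> K^o).
Proof.
move=> bB a x y.
pose S := (finsupp (coords B x) `|` finsupp (coords B y))%fset.
rewrite (@sum_coefE B _ S) ?finsupp_coordsP //.
rewrite (@sum_coefE B x S) ?fsubsetUl // (@sum_coefE B y S) ?fsubsetUr //.
rewrite scaler_sumr -big_split; apply: eq_bigr => z _ /=.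
by rewrite (@coefP _ setT).
Qed.

Lemma sum_coef_basis B b : is_basis B setT -> B b -> sum_coef B b = 1.
Proof.
move=> bB Bb; rewrite (@sum_coefE B _ [fset b]%fset).
  by rewrite big_seq_fset1 (coef_basis _ bB) // eqxx.
apply/fsubsetP => z; rewrite mem_finsupp in_fset1.
have := coef_basis z bB Bb; rewrite /coef => ->.
by case: (z == b) => //=; rewrite eqxx.
Qed.

Definition spans B (x : V) :=
  exists2 s : seq (K * V), (forall p, p \in s -> B p.2)
    & x = \sum_(p <- s) p.1 *: p.2.

Lemma spans_sum B I (r : seq I) (E : I -> V) :
  (forall i, spans B (E i)) -> spans B (\sum_(i <- r) E i).
Proof.
move=> h; elim: r => [|i r [s sB es]]; first by exists [::]; rewrite ?big_nil.
have [t tB et] := h i; exists (t ++ s).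
  by move=> p; rewrite mem_cat => /orP[/tB|/sB].
by rewrite big_cons big_cat et es.
Qed.

Lemma spans_basis B W x : is_basis B W -> W x -> spans B x.
Proof.
move=> bB Wx; exists [seq (coef B x b, b) | b <- finsupp (coords B x)].
  move=> p /mapP[b bs ->] /=; exact: (expandsP bB Wx).1.
by rewrite big_map; apply: expand_basis Wx.
Qed.

(** A functional equal to 1 at b and 0 at the rest of B reads off the coefficient of b from any
    expansion, which forces uniqueness. *)
Lemma dual_basis B : (forall x, spans B x) ->
  (forall b, B b -> exists2 phi : V -> K^o, linear phi &
     forall b', B b' -> phi b' = (b' == b)%:R) ->
  is_basis B setT.
Proof.
move=> sp du; split=> // x _.
have uniq_c c b phi : linear (phi : V -> K^o) ->
    (forall b', B b' -> phi b' = (b' == b)%:R) -> [set` finsupp c] `<=` B ->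
    phi (lincomb c) = c b.
  move=> lphi ephi cB; rewrite /lincomb lin_sum //.
  rewrite (eq_big_seq (fun z => if z == b then c b : K^o else 0)); last first.
    move=> z zc; rewrite linZ // ephi; last exact: cB.
    case: eqP => [->|_]; first by rewrite /GRing.scale /= mulr1.
    by rewrite scaler0.
  case: (boolP (b \in finsupp c)) => [bc|bn].
    by rewrite -big_mkcond -big_filter (@filter_pred1_uniq _ _ b) ?fset_uniq // big_seq1.
  rewrite fsfun_dflt // big1_seq // => z /andP[_ zc].
  by case: eqP => // _.
have [s sB es] := sp x.
pose S := [fset p.2 | p in s]%fset.
(* The list s may repeat a vector, so its scalars are collected vector by vector. *)
pose c : {fsfun V -> K with 0} :=
  [fsfun b in S => \sum_(p <- s | p.2 == b) p.1].
have cS : (finsupp c `<=` S)%fset by apply: finsupp_sub.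
have ec : expands B c x.
  split.
    move=> z /= /(fsubsetP cS) /imfsetP[p /= ps ->]; exact: sB.
  rewrite (lincomb_sub cS) es.
  rewrite (eq_big_seq (fun b => \sum_(p <- s | p.2 == b) p.1 *: p.2)).
    rewrite (exchange_big_dep predT) //=; apply: eq_big_seq => p ps.
    have pS : p.2 \in S by apply/imfsetP; exists p.
    rewrite -big_filter (@eq_filter _ _ (pred1 p.2)); last first.
      by move=> z /=; rewrite eq_sym.
    by rewrite filter_pred1_uniq ?fset_uniq // big_seq1.
  move=> b bS; rewrite fsfunE bS scaler_suml; apply: eq_bigr => p /eqP ->.
  by [].
exists c; split=> // c' [c'B ec']; apply/fsfunP => b.
case: (pselect (B b)) => [Bb|nBb].
  have [phi lphi ephi] := du b Bb.
  rewrite -(uniq_c c b phi) // ?ec.1 -?ec.2 //; last by case: ec.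
  by rewrite ec' (uniq_c c' b phi).
rewrite !fsfun_dflt //; apply/negP => bs; apply: nBb; [exact: c'B|exact: ec.1].
Qed.

Lemma basis_sum (S : {fset V}) W x : is_basis [set` S] W -> W x ->
  x = \sum_(b <- S) coef [set` S] x b *: b.
Proof.
move=> bB Wx; rewrite -(lincomb_sub (c := coords [set` S] x)).
  by case: (expandsP bB Wx).
by apply/fsubsetP => z; apply: (expandsP bB Wx).1.
Qed.

End BasisTheory.

(** Products of coordinate functionals are dual to the pure tensors of basis elements, so
    [dual_basis] applies. *)
Lemma tens_basis (K : fieldType) (U V : lmodType K) (B : set U) (C : set V) :
  is_basis B setT -> is_basis C setT -> is_basis (tens_set B C) setT.
Proof.
move=> bB bC; apply: dual_basis => [x|_ [b [c [Bb Cc ->]]]].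
  rewrite [x]tensor_sum; apply: spans_sum => -[u v] /=.
  have [s sB ->] := spans_basis (x := u) bB I.
  have [t tC ->] := spans_basis (x := v) bC I.
  rewrite (lin_sum (f := fun z : U => tens z _)) => [|a y z]; last by rewrite (tens_bilinear U V).1.
  exists [seq (p.1 * q.1, tens p.2 q.2) | p <- s, q <- t].
    move=> _ /allpairsP[[p q] /= [ps qt ->]] /=.
    by exists p.2, q.2; split; [exact: sB|exact: tC|].
  rewrite big_allpairs_dep; apply: eq_bigr => p _ /=.
  rewrite lin_sum => [|a y z]; last by rewrite (tens_bilinear U V).2.
  apply: eq_bigr => q _; rewrite (linZ (f := fun z : U => tens z _)) => [|a y z];
    last by rewrite (tens_bilinear U V).1.
  rewrite linZ ?scalerA // => a y z; by rewrite (tens_bilinear U V).2.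
pose h u v : K^o := (coef B u b : K^o) *: (coef C v c : K^o).
have bh : is_bilinear h.
  exact: (bilin_comp (@scale_bilin K K^o) (coef_linear b bB) (coef_linear c bC)).
exists (tlift h); first exact: tlift_linear.
have hE b' c' : B b' -> C c' -> h b' c' = ((b == b') && (c == c'))%:R.
  move=> Bb' Cc'; rewrite /h (coef_basis _ bB) // (coef_basis _ bC) //.
  by rewrite /GRing.scale /= -natrM mulnb.
move=> _ [b' [c' [Bb' Cc' ->]]]; rewrite tlift_tens // hE //.
have bc1 : h b c = 1 by rewrite hE // !eqxx.
(* Distinct pairs are not known in advance to give distinct tensors: equal tensors have equal values
   under h, and unequal tensors come from unequal pairs. *)
case: (eqVneq (tens b' c') (tens b c)) => [e|ne].
  by rewrite -hE // -(tlift_tens b' c' bh) e tlift_tens.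
by case: eqP => [eb|//]; case: eqP => [ec|//]; rewrite eb ec eqxx in ne.
Qed.

Lemma tpow_basis (K : fieldType) (V : lmodType K) (B : set V) n :
  is_basis B setT -> is_basis (tpow_set B n) setT.
Proof. by move=> bB; elim: n => [//|n IHn]; apply: tens_basis. Qed.

(** * Graded pieces and the total basis *)

Section GradingTheory.
Context (K : fieldType) (V : lmodType K) (G : grading V).

Lemma proj_linear n : linear (proj G n).
Proof. exact: linearP. Qed.

Lemma piece_lin_closed n : lin_closed (piece G n).
Proof.
move=> a x y px py; have <- : proj G n (a *: x + y) = a *: x + y by rewrite linearP !proj_id.
exact: proj_piece.
Qed.

Lemma piece0r n : piece G n 0.
Proof. by rewrite -(linear0 (proj G n)); apply: proj_piece. Qed.

Lemma pieceZ n a x : piece G n x -> piece G n (a *: x).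
Proof.
by move=> px; rewrite -[_ *: _]addr0; apply: piece_lin_closed => //; apply: piece0r.
Qed.

Lemma piece_sum n I (r : seq I) (P : pred I) (E : I -> V) :
  (forall i, P i -> piece G n (E i)) -> piece G n (\sum_(i <- r | P i) E i).
Proof.
move=> h; elim/big_ind: _ => //; first exact: piece0r.
by move=> x y px py; rewrite -[x]scale1r; apply: piece_lin_closed.
Qed.

Lemma grading_ext (U : lmodType K) (f g : V -> U) : linear f -> linear g ->
  (forall n x, piece G n x -> f x = g x) -> f =1 g.
Proof.
move=> lf lg e x; have [N ->] := sum_proj G x.
rewrite !lin_sum //; apply: eq_bigr => i _; apply: e; exact: proj_piece.
Qed.

Lemma total_basis_basis (B : nat -> {fset V}) :
  (forall n, is_basis [set` B n] (piece G n)) ->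
  is_basis (\bigcup_n [set` B n]) setT.
Proof.
move=> gB.
pose phi n b x : K^o := coef [set` B n] (proj G n x) b.
have lphi n b : linear (phi n b).
  move=> a x y; rewrite /phi linearP (coefP _ _ (gB n)) //.
  - exact: piece_lin_closed.
  - exact: proj_piece.
  - exact: proj_piece.
apply: dual_basis => [x|b [n _ /= bn]].
  have [N ->] := sum_proj G x; apply: spans_sum => i.
  have [s sB ->] := spans_basis (gB i) (proj_piece G i x).
  by exists s => // p /sB; exists (i : nat).
have pb : piece G n b by apply: (gB n).1.
exists (phi n b) => // b' [m _ /= bm]; have pb' : piece G m b' by apply: (gB m).1.
case: (eqVneq m n) => [e|/eqP ne].
  move: bm pb'; rewrite e => bm pb'.
  by rewrite /phi proj_id // (coef_basis _ (gB n)) // eq_sym.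
have phi0 : phi n b b' = 0.
  by rewrite -(lin0 (lphi n b)) /phi (proj_off ne pb') linear0.
(* No element lies in bases of two different degrees: its functional would take both values 0 and 1
   there. *)
rewrite phi0; case: eqP => // ebb; move: phi0; rewrite ebb /phi proj_id //.
by rewrite (coef_basis _ (gB n)) // eqxx => /eqP; rewrite oner_eq0.
Qed.

Lemma coords_piece (B : nat -> {fset V}) n x :
  (forall n, is_basis [set` B n] (piece G n)) -> piece G n x ->
  coords (\bigcup_n [set` B n]) x = coords [set` B n] x.
Proof.
move=> gB px; apply: (coords_uniq (total_basis_basis gB)) => //.
have [h1 h2] := expandsP (gB n) px.
by split=> // z /h1 zB; exists n.
Qed.

End GradingTheory.

(** * The derivation and its convolution powers *)

Section HopfTheory.
Context (K : fieldType) (H : algType K) (hH : graded_connected_hopf H).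
Context (B : nat -> {fset H}) (gB : graded_basis hH B).

Local Notation BB := (total_basis B).
Local Notation eps := (counit hH).
Local Notation pc := (piece hH).

Lemma BB_basis : is_basis BB setT.
Proof. exact: total_basis_basis gB. Qed.

Lemma counit_linear : linear (eps : H -> K^o).
Proof. by move=> a x y; exact: linearP. Qed.

Lemma comul_linear : linear (comul hH).
Proof. exact: linearP. Qed.

(** Connectedness makes degree 0 a line containing the nonzero vector 1; the counit, being 1 there,
    reads off the multiple. *)
Lemma piece0P x : pc 0 x -> x = eps x *: 1.
Proof.
move=> px; have [S /eqP/cardfs1P[u ->] bS] := piece_connected hH.
have ex y : pc 0 y -> exists c, y = c *: u.
  by move=> py; eexists; rewrite {1}(basis_sum bS py) big_seq_fset1.
have [c ec] := ex _ px; have [c1 ec1] := ex _ (piece1 hH).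
have c1n : c1 != 0.
  by apply: contra_eq_neq ec1 => ->; rewrite scale0r oner_neq0.
have -> : x = (c / c1) *: 1 by rewrite ec1 scalerA divfK.
by rewrite linearZ /= counit1 mulr1.
Qed.

Lemma proj0E x : proj hH 0 x = eps x *: 1.
Proof.
move: x; apply: (grading_ext (G := hH)).
- exact: proj_linear.
- by move=> a x y; rewrite linearP scalerDl scalerA.
move=> [|n] x px; first by rewrite proj_id //; apply: piece0P.
by rewrite (proj_off _ px) // (piece_counit (ltn0Sn n) px) scale0r.
Qed.

Definition eps1 (x : H) : K^o := sum_coef BB (proj hH 1 x).

Lemma eps1_linear : linear eps1.
Proof.
apply: lin_comp; last exact: proj_linear.
exact: (sum_coef_linear BB_basis).
Qed.

Lemma eps1_off i x : pc i x -> i <> 1%N -> eps1 x = 0.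
Proof.
move=> px ne; rewrite /eps1 (proj_off ne px).
exact: (lin0 (sum_coef_linear BB_basis)).
Qed.

(** By bilinearity the factors may be taken homogeneous. A factor of degree 0 is a scalar by
    connectedness; if both degrees are positive, the product has degree at least 2 and both sides
    vanish. *)
Lemma eps1M x y : eps1 (x * y) = eps x * eps1 y + eps1 x * eps y.
Proof.
have lmul (f : H -> K^o) (z : K) : linear f -> linear (fun x => f x * z : K^o).
  by move=> lf a u v; rewrite lf mulrDl /GRing.scale /= mulrA.
have mull (f : H -> K^o) (z : K) : linear f -> linear (fun x => z * f x : K^o).
  by move=> lf a u v; rewrite lf mulrDr /GRing.scale /= mulrCA.
have ladd (f g : H -> K^o) : linear f -> linear g ->
    linear (fun x => f x + g x : K^o).
  by move=> lf lg a u v; rewrite lf lg scalerDr addrACA.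
have l1 := eps1_linear; have l0 := counit_linear.
move: x; apply: (grading_ext (G := hH)).
- by apply: lin_comp => // a u v; rewrite mulrDl scalerAl.
- by apply: ladd; apply: lmul.
move=> i x px; move: y; apply: (grading_ext (G := hH)).
- by apply: lin_comp => // a u v; rewrite mulrDr scalerAr.
- by apply: ladd; apply: mull.
move=> j y py.
case: i px => [|i] px.
  rewrite [in LHS](piece0P px) -scalerAl mul1r (linZ l1) (eps1_off px) //.
  by rewrite mul0r addr0.
case: j py => [|j] py.
  rewrite [in LHS](piece0P py) -scalerAr mulr1 (linZ l1) (eps1_off py) //.
  by rewrite mulr0 add0r mulrC.
rewrite (eps1_off (pieceM px py)) ?addSn ?addnS //.
by rewrite (piece_counit (ltn0Sn _) px) (piece_counit (ltn0Sn _) py) mul0r mulr0 addr0.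
Qed.

(* A derivation of degree -1, since eps1 is an infinitesimal character; eta   *)
(* on degree n is its n-th iterate followed by the counit.                    *)
Definition der (x : H) : H := tlift (fun a b => eps1 a *: b) (comul hH x).

Lemma eps1_bilin (V : lmodType K) (f : H -> V) : linear f ->
  is_bilinear (fun a b => eps1 a *: f b).
Proof.
move=> lf; exact: (bilin_comp (scale_bilin V) eps1_linear lf).
Qed.

Lemma der_linear : linear der.
Proof.
apply: lin_comp; last exact: comul_linear.
by apply: tlift_linear; apply: eps1_bilin.
Qed.

Lemma der_piece n x : pc n.+1 x -> pc n (der x).
Proof.
move=> px; have [s sP e] := piece_comul px.
rewrite /der e tlift_pres; last exact: eps1_bilin.
rewrite big_seq; apply: piece_sum => p /sP [i [j [ij p1 p2]]].
case: (eqVneq i 1%N) => [i1|/eqP ne].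
  by apply: pieceZ; move: ij; rewrite i1 add1n => -[<-].
by rewrite (eps1_off p1) // scale0r; apply: piece0r.
Qed.

Lemma der_piece0 x : pc 0 x -> der x = 0.
Proof.
move=> px; have [s sP e] := piece_comul px.
rewrite /der e tlift_pres; last exact: eps1_bilin.
rewrite big_seq big1 // => p /sP [i [j [ij p1 p2]]].
by rewrite (eps1_off p1) ?scale0r //; case: i ij {p1}.
Qed.

(** The coproduct is multiplicative and [eps1M] splits each term in two; in each half, the factor
    contracted with the counit collapses back to x or to y. *)
Lemma derM x y : der (x * y) = der x * y + x * der y.
Proof.
pose F : tensor H H -> H := tlift (fun a b => eps1 a *: b).
have bF := eps1_bilin (@lin_id K H).
have lF : linear F by apply: tlift_linear.
have FE u v : F (tens u v) = eps1 u *: v by rewrite /F tlift_tens.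
have epsE z : z = \sum_(p <- repr (comul hH z)) eps p.1 *: p.2.
  by rewrite -[LHS](counitl hH).
have derE z : der z = \sum_(p <- repr (comul hH z)) eps1 p.1 *: p.2 by [].
rewrite -[der (x * y)]/(F _) comulM /tens_mul comp_tlift //.
under eq_tlift => a b do rewrite comp_tlift //.
rewrite [X in _ = _ * X + _]epsE [X in _ = _ + X * _]epsE !derE /tlift /fsum.
rewrite !big_distrlr -big_split; apply: eq_bigr => p _ /=.
rewrite -big_split; apply: eq_bigr => q _ /=.
rewrite FE eps1M addrC scalerDl.
by rewrite -!scalerAl -!scalerAr !scalerA.
Qed.

(** Coassociativity: contract the first of three tensor factors with [eps1]. Having split the right
    factor of the coproduct gives the left side, having split the left factor gives the right
    side. *)
Lemma der_comul x : comul hH (der x) = tmap der id (comul hH x).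
Proof.
pose F : tensor H (tensor H H) -> tensor H H := tlift (fun a t => eps1 a *: t).
have bF : is_bilinear (fun a (t : tensor H H) => eps1 a *: t).
  exact: (bilin_comp (scale_bilin (tensor H H)) eps1_linear (@lin_id K _)).
have lF : linear F by apply: tlift_linear.
have b3 (w : H) : is_bilinear (fun u v : H => tens u (tens v w)).
  apply: (bilin_comp (tens_bilinear _ _) (@lin_id K _)) => a u v.
  by rewrite (tens_bilinear H H).1.
have b4 : is_bilinear (fun (t : tensor H H) (w : H) =>
    tlift (fun u v => tens u (tens v w)) t).
  split=> [w|t a w w']; first exact: tlift_linear.
  rewrite /= /tlift /fsum scaler_sumr -big_split; apply: eq_bigr => p _ /=.
  by rewrite (tens_bilinear H H).2 (tens_bilinear _ _).2.
have -> : comul hH (der x) = F (tmap id (comul hH) (comul hH x)).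
  rewrite /F tlift_tmap //; last exact: comul_linear.
  rewrite /der comp_tlift; last exact: comul_linear.
  by apply: eq_tlift => a b; rewrite linearZ.
rewrite -comulA; move: (comul hH x); apply: tens_ext.
- apply: lin_comp => //; apply: lin_comp; first exact: tlift_linear.
  by apply: tmap_linear => //; apply: comul_linear.
- by apply: tmap_linear => //; apply: der_linear.
move=> a w; rewrite !tmap_tens //; [|exact: der_linear|exact: comul_linear].
rewrite /tassoc tlift_tens // (comp_tlift _ _ lF).
have lw : linear (fun z : H => tens z w).
  by move=> c u v; rewrite (tens_bilinear H H).1.
rewrite [RHS](comp_tlift _ _ lw); apply: eq_tlift => u v.
by rewrite /F tlift_tens // (linZ lw).
Qed.

Definition epow n (x : H) : K^o := eps (iter n der x).

Lemma epowS n x : epow n.+1 x = epow n (der x).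
Proof. by rewrite /epow iterSr. Qed.

Lemma epow_linear n : linear (epow n).
Proof.
elim: n => [|n IHn]; first exact: counit_linear.
by move=> a x y; rewrite !epowS der_linear IHn.
Qed.

Lemma epow1 x : epow 1 x = eps1 x.
Proof.
rewrite epowS /epow /= /der (comp_tlift _ _ counit_linear).
rewrite -{2}[x](counitr hH) (comp_tlift _ _ eps1_linear).
by apply: eq_tlift => a b; rewrite linearZ (linZ eps1_linear) /= mulrC.
Qed.

Lemma epow_off i n x : pc i x -> i <> n -> epow n x = 0.
Proof.
elim: n i x => [|n IHn] [|i] x px ne //.
- by rewrite /epow (piece_counit (ltn0Sn _) px).
- by rewrite epowS (der_piece0 px) (lin0 (epow_linear n)).
- by rewrite epowS (IHn i) //; [exact: der_piece|move=> e; apply: ne; rewrite e].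
Qed.

Lemma epow_proj n x : epow n (proj hH n x) = epow n x.
Proof.
move: x; apply: (grading_ext (G := hH)).
- by apply: lin_comp; [exact: epow_linear|exact: proj_linear].
- exact: epow_linear.
move=> m x px; case: (eqVneq m n) => [<-|/eqP ne]; first by rewrite proj_id.
by rewrite (proj_off ne px) (lin0 (epow_linear n)) (epow_off px).
Qed.

(** [der_comul] pulls each [der] on the left tensor factor out to x, so the [epow i] behave as
    convolution powers. *)
Lemma epowD i j x :
  tlift (fun a b => (epow i a : K^o) *: epow j b) (comul hH x) = epow (i + j) x.
Proof.
have b2 k : is_bilinear (fun a b => (epow k a : K^o) *: epow j b).
  exact: (bilin_comp (scale_bilin K^o) (epow_linear k) (epow_linear j)).
elim: i x => [|i IHi] x.
  rewrite add0n -{2}[x](counitl hH) (comp_tlift _ _ (epow_linear j)).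
  by apply: eq_tlift => a b; rewrite (linZ (epow_linear j)).
rewrite addSn epowS -IHi der_comul tlift_tmap //; last exact: der_linear.
by apply: eq_tlift => a b; rewrite epowS.
Qed.

(** Induction on the total degree: the two terms of Leibniz' rule carry the binomials that Pascal's
    rule adds. *)
Lemma epowM i j x y : pc i x -> pc j y ->
  epow (i + j) (x * y) = 'C(i + j, i)%:R * epow i x * epow j y.
Proof.
have [n ij] : exists n, (i + j)%N = n by exists (i + j)%N.
rewrite ij; elim: n i j ij x y => [|n IHn].
  move=> [|i] [|j] // _ x y px py; rewrite bin0 mul1r.
  by rewrite /epow /= counitM.
move=> i j ij x y px py.
have l := epow_linear; rewrite epowS derM (linD (l n)).
(* A factor of degree 0 is a scalar killed by [der], so only one Leibniz term remains. *)
case: i ij px => [|i] ij px.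
  rewrite (der_piece0 px) mul0r (lin0 (l n)) add0r bin0 mul1r.
  rewrite [in LHS](piece0P px) -scalerAl mul1r (linZ (l n)) -epowS.
  by rewrite -ij add0n.
case: j ij py => [|j] ij py.
  rewrite (der_piece0 py) mulr0 (lin0 (l n)) addr0.
  rewrite [in LHS](piece0P py) -scalerAr mulr1 (linZ (l n)) -epowS.
  by rewrite -ij addn0 binn mul1r mulrC.
have [ij1 ij2] : (i + j.+1)%N = n /\ (i.+1 + j)%N = n.
  by move: ij; rewrite addSn addnS => -[<-]; rewrite addSn.
rewrite (IHn _ _ ij1 _ _ (der_piece px) py) (IHn _ _ ij2 _ _ px (der_piece py)).
by rewrite -!epowS binS addrC natrD !mulrDl.
Qed.

End HopfTheory.

(** * Identification of eta with a convolution power *)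

Section Eta.
Context (K : fieldType) (H : algType K) (hH : graded_connected_hopf H).
Context (B : nat -> {fset H}) (gB : graded_basis hH B).

Local Notation BB := (total_basis B).
Local Notation eps := (counit hH).
Local Notation pc := (piece hH).
Local Notation eps1 := (eps1 hH B).
Local Notation der := (der hH B).
Local Notation epow := (epow hH B).

(** A free functional on the last factor lets a coproduct there be absorbed as one [der], which
    drives the induction in [eps1_tpow_icomul]. *)
Fixpoint eps1_tpow (n : nat) (phi : H -> K^o) : tpow H n -> K^o :=
  match n return tpow H n -> K^o with
  | 0 => phi
  | n'.+1 => tlift (fun a t => eps1 a *: eps1_tpow (n := n') phi t)
  end.

Lemma eps1_tpow_linear n phi : linear phi -> linear (@eps1_tpow n phi).
Proof.
move=> lphi; elim: n => [|n IHn] //; apply: tlift_linear.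
exact: (bilin_comp (@scale_bilin K K^o) (eps1_linear gB) IHn).
Qed.

Lemma eps1_tpow_bilin n phi : linear phi ->
  is_bilinear (fun a (t : tpow H n) => eps1 a *: eps1_tpow phi t).
Proof.
move=> lphi.
exact: (bilin_comp (@scale_bilin K K^o) (eps1_linear gB) (eps1_tpow_linear lphi)).
Qed.

Lemma comul_last_linear n : linear (@comul_last K H hH n).
Proof.
elim: n => [|n IHn] /=; first exact: comul_linear.
exact: tmap_linear.
Qed.

Lemma eps1_tpow_last n phi t : linear phi ->
  eps1_tpow phi (@comul_last K H hH n t) = eps1_tpow (fun x => phi (der x)) t.
Proof.
move=> lphi; elim: n t => [|n IHn] t.
  rewrite -[RHS]/(phi (tlift (fun a b => eps1 a *: b) (comul hH t))) /=.
  rewrite (comp_tlift _ _ lphi); apply: eq_tlift => a b.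
  by rewrite (linZ lphi).
rewrite -[LHS]/(tlift (fun a u => eps1 a *: @eps1_tpow n.+1 phi u)
  (tmap id (@comul_last K H hH n) t)) tlift_tmap //; first by apply: eq_tlift => a b; rewrite IHn.
- exact: (eps1_tpow_bilin n.+1 lphi).
- exact: comul_last_linear.
Qed.

Lemma eps1_tpow_icomul n phi x : linear phi ->
  eps1_tpow phi (icomul hH n x) = phi (iter n der x).
Proof.
elim: n phi x => [//|n IHn] phi x lphi.
rewrite [icomul _ _ _]/= eps1_tpow_last // IHn //.
by apply: lin_comp => //; apply: der_linear.
Qed.

(** Both sides are bilinear and equal 1 on pairs of basis elements. *)
Lemma sum_coef_tens n (u : H) (t : tpow H n) :
  sum_coef (tpow_set BB n.+1) (tens u t) =
  (sum_coef BB u : K^o) *: (sum_coef (tpow_set BB n) t : K^o).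
Proof.
have bB := BB_basis gB; have bT := tpow_basis n bB.
have bT1 := tpow_basis n.+1 bB.
have bS := bilin_comp (@scale_bilin K K^o) (sum_coef_linear bB) (sum_coef_linear bT).
have lT1 := sum_coef_linear bT1.
have bL := comp_bilin lT1 (tens_bilinear H (tpow H n)).
move: u; apply: (basis_ext bB (bL.1 t) (bS.1 t)) => u /set_mem Bu.
move: t; apply: (basis_ext bT (bL.2 u) (bS.2 u)) => t /set_mem Bt.
rewrite (sum_coef_basis bB Bu) (sum_coef_basis bT Bt) (sum_coef_basis bT1).
  by rewrite scale1r.
by exists u, t.
Qed.

Lemma tpow_map_linear n (f : H -> H) : linear f -> linear (@tpow_map K H f n).
Proof. by move=> lf; elim: n => [|n IHn] //=; apply: tmap_linear. Qed.

Lemma sum_coef_tpow n (t : tpow H n) :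
  sum_coef (tpow_set BB n) (tpow_map (proj hH 1) t) = eps1_tpow eps1 t.
Proof.
have bB := BB_basis gB; have lp := @proj_linear _ _ hH 1%N.
elim: n t => [//|n IHn].
have lm := @tpow_map_linear n _ lp; have b1 := eps1_tpow_bilin n (eps1_linear gB).
apply: (@tens_ext K H (tpow H n) K^o).
- apply: (lin_comp (sum_coef_linear (tpow_basis n.+1 bB))).
  exact: (tmap_linear lp lm).
- exact: (tlift_linear b1).
move=> u t; rewrite [tpow_map _ _]/= tmap_tens // sum_coef_tens IHn.
by rewrite [RHS]/= tlift_tens.
Qed.

Lemma etaE n x : (0 < n)%N -> eta hH B n x = epow n x.
Proof.
case: n => // n _; rewrite /eta /= sum_coef_tpow.
(* In degree [n.+1] there are n coproducts; the [eps1] on the last factor is [epow 1] and supplies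
   the remaining [der]. *)
rewrite (eps1_tpow_icomul _ _ (eps1_linear gB)) -(epow1 gB).
exact: erefl.
Qed.

(** * Convolutions of projections *)

(** The multinomial coefficient as a product of binomials, the form in which nested convolutions
    produce it. *)
Fixpoint multi (s : seq nat) : nat :=
  if s is d :: s' then 'C(d + sumn s', d) * multi s' else 1.

Lemma multi_fact s : (sumn s)`! = (multi s * \prod_(d <- s) d`!)%N.
Proof.
elim: s => [|d s IHs] /=; first by rewrite big_nil.
rewrite big_cons -(bin_fact (leq_addr (sumn s) d)) addKn IHs.
by rewrite [(d`! * (_ * _))%N]mulnCA !mulnA.
Qed.

Lemma conv_tlift (f g : H -> H) x : linear f -> linear g ->
  conv (comul hH) f g x = tlift (fun a b => f a * g b) (comul hH x).
Proof. by move=> lf lg; rewrite /conv /mulmap tlift_tmap //; apply: mul_bilin. Qed.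

Lemma conv_linear (f g : H -> H) : linear f -> linear g ->
  linear (conv (comul hH) f g).
Proof.
move=> lf lg; apply: (lin_comp (f := @mulmap K H)).
  by apply: tlift_linear; apply: mul_bilin.
apply: lin_comp; first exact: tmap_linear.
exact: comul_linear.
Qed.

Lemma conv_projS d d' s :
  conv_proj hH [:: d, d' & s] =
  conv (comul hH) (proj hH d) (conv_proj hH (d' :: s)).
Proof. by []. Qed.

Lemma conv_proj_linear d s : linear (conv_proj hH (d :: s)).
Proof.
elim: s d => [|d' s IHs] d; first exact: proj_linear.
by rewrite conv_projS; apply: conv_linear => //; apply: proj_linear.
Qed.

Lemma conv_proj_piece d s x : pc (d + sumn s) (conv_proj hH (d :: s) x).
Proof.
elim: s d x => [|d' s IHs] d x; first by rewrite addn0; apply: proj_piece.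
rewrite conv_projS conv_tlift; [|exact: proj_linear|exact: conv_proj_linear].
rewrite /tlift /fsum; apply: piece_sum => p _; apply: pieceM; last exact: IHs.
exact: proj_piece.
Qed.

(** Each convolution contributes one binomial through [epowM], and [epowD] then reassembles the two
    tensor factors. *)
Lemma epow_conv_proj d s x :
  epow (d + sumn s) (conv_proj hH (d :: s) x) =
  (multi (d :: s))%:R * epow (d + sumn s) x.
Proof.
have l := epow_linear gB.
elim: s d x => [|d' s IHs] d x.
  by rewrite /= addn0 binn mul1n mul1r; apply: epow_proj.
rewrite conv_projS conv_tlift; [|exact: proj_linear|exact: conv_proj_linear].
rewrite (comp_tlift _ _ (l _)) -(epowD gB) /tlift /fsum mulr_sumr.
apply: eq_bigr => p _.
rewrite (epowM gB (proj_piece _ _ _) (conv_proj_piece _ _ _)) IHs epow_proj //.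
rewrite -[multi [:: d, d' & s]]/('C(d + (d' + sumn s), d) * multi (d' :: s))%N.
by rewrite natrM /GRing.scale /= mulrACA.
Qed.

End Eta.

(** * The operator Psi and the row sums of its kernel *)

Section PsiTheory.
Context (n a : nat) (K : fieldType) (alpha : a.-tuple 'I_n.+1 -> K).
Context (H : algType K) (hH : graded_connected_hopf H).
Context (B : nat -> {fset H}) (gB : graded_basis hH B).
Context (a_gt0 : (0 < a)%N).
Local Notation epow := (epow hH B).

(** Passes from tuples to nonempty lists, where induction is possible; by [multi_fact] the integer
    division in [multinomial] is exact. *)
Lemma weak_comp_cons (D : a.-tuple 'I_n.+1) : weak_comp D ->
  exists d s, [/\ [seq (d : nat) | d : 'I_n.+1 <- D] = d :: s,
    (d + sumn s)%N = n & multinomial D = multi (d :: s)].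
Proof.
rewrite /weak_comp /multinomial => /eqP.
rewrite -(big_map (fun d : 'I_n.+1 => (d : nat)) predT id) /=.
rewrite -(big_map (fun d : 'I_n.+1 => (d : nat)) predT (fun m => m`!)) /=.
have : size [seq (d : nat) | d : 'I_n.+1 <- D] = a by rewrite size_map size_tuple.
case: [seq _ | _ <- D] => [sz|d s _]; first by move: (a_gt0); rewrite -sz.
rewrite -sumnE /= => e; exists d, s; split => //.
have := multi_fact (d :: s); rewrite [sumn _]/= e => ->; rewrite mulnK -?e //.
by rewrite prodn_gt0 // => i; apply: fact_gt0.
Qed.

Lemma Psi_piece x : piece hH n (Psi alpha hH x).
Proof.
apply: piece_sum => D /weak_comp_cons[d [s [-> e _]]].
by apply: pieceZ; rewrite -{1}e; apply: conv_proj_piece.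
Qed.

(** Each summand of Psi scales [epow n] by its multinomial coefficient. The resulting eigenvector
    equation is what normalises the rows. *)
Lemma epow_Psi x : epow n (Psi alpha hH x) = beta alpha * epow n x.
Proof.
have l := epow_linear gB n.
rewrite /Psi /beta (lin_sum l) mulr_suml; apply: eq_bigr => D.
move=> /weak_comp_cons[d [s [-> e ->]]].
rewrite (linZ l) -[in LHS]e (epow_conv_proj gB) e.
by rewrite /GRing.scale /= mulrA.
Qed.

Lemma coef_piece x y : piece hH n x ->
  coef (total_basis B) x y = coef [set` B n] x y.
Proof. by move=> px; rewrite /coef /total_basis (coords_piece gB px). Qed.

Lemma piece_expand x : piece hH n x ->
  x = \sum_(b <- B n) coef (total_basis B) x b *: b.
Proof.
move=> px; rewrite [LHS](basis_sum (gB n) px); apply: eq_bigr => b _.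
by rewrite coef_piece.
Qed.

Lemma trans_row_sum x : (0 < n)%N -> eta hH B n x * beta alpha != 0 ->
  \sum_(y <- B n) trans alpha hH B x y = 1.
Proof.
move=> n0 nz; have l := epow_linear gB n.
have key : \sum_(y <- B n) eta hH B n y * coef (total_basis B) (Psi alpha hH x) y =
    eta hH B n x * beta alpha.
  rewrite [RHS]mulrC [in RHS](etaE gB) // -epow_Psi.
  rewrite [in RHS](piece_expand (Psi_piece x)) (lin_sum l).
  by apply: eq_bigr => y _; rewrite (linZ l) (etaE gB) // mulrC.
have -> : 1 = (eta hH B n x * beta alpha) / (eta hH B n x * beta alpha) by rewrite divff.
rewrite -{1}key mulr_suml; apply: eq_bigr => y _.
exact: mulrAC.
Qed.

End PsiTheory.

(** * Positivity for a state space basis *)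

Section Positivity.
Context (K : realFieldType) (H : algType K) (hH : graded_connected_hopf H).
Context (B : nat -> {fset H}) (hB : state_space_basis hH B).

Local Notation BB := (total_basis B).
Local Notation eps := (counit hH).
Local Notation pc := (piece hH).
Local Notation eps1 := (eps1 hH B).
Local Notation der := (der hH B).
Local Notation epow := (epow hH B).

Let gB : graded_basis hH B. Proof. by case: hB. Qed.
Let bB : is_basis BB setT. Proof. exact: BB_basis gB. Qed.

Definition nonneg (x : H) := forall y, 0 <= coef BB x y.

Lemma nonneg_lin a x y : 0 <= a -> nonneg x -> nonneg y ->
  nonneg (a *: x + y).
Proof.
by move=> a0 nx ny z; rewrite (coefP _ _ bB) //; rewrite addr_ge0 // mulr_ge0.
Qed.

Lemma nonneg0 : nonneg 0.
Proof. by move=> z; rewrite (lin0 (coef_linear z bB)). Qed.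

Lemma nonnegZ a x : 0 <= a -> nonneg x -> nonneg (a *: x).
Proof. by move=> a0 nx; rewrite -[_ *: _]addr0; apply: nonneg_lin nonneg0. Qed.

Lemma nonneg_sum I (r : seq I) (P : pred I) (E : I -> H) :
  (forall i, P i -> nonneg (E i)) -> nonneg (\sum_(i <- r | P i) E i).
Proof.
move=> h; elim/big_ind: _ => //; first exact: nonneg0.
by move=> x y nx ny; rewrite -[x]scale1r; apply: nonneg_lin.
Qed.

Lemma nonneg_basis b : BB b -> nonneg b.
Proof. by move=> Bb y; rewrite (coef_basis _ bB Bb) ler0n. Qed.

Lemma nonneg_map (f : H -> H) x : linear f ->
  (forall b, BB b -> nonneg (f b)) -> nonneg x -> nonneg (f x).
Proof.
move=> lf h nx; rewrite (expand_basis (x := x) bB I) (lin_sum lf) big_seq.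
apply: nonneg_sum => b bs; rewrite (linZ lf); apply: nonnegZ => //.
by apply: h; apply: (expandsP (x := x) bB I).1.
Qed.

Lemma nonneg_fun (f : H -> K^o) x : linear f ->
  (forall b, BB b -> 0 <= (f b : K)) -> nonneg x -> 0 <= (f x : K).
Proof.
move=> lf h nx; rewrite (expand_basis (x := x) bB I) (lin_sum lf) big_seq.
apply: sumr_ge0 => b bs; rewrite (linZ lf); apply: mulr_ge0 => //.
by apply: h; apply: (expandsP (x := x) bB I).1.
Qed.

Lemma nonnegM x y : nonneg x -> nonneg y -> nonneg (x * y).
Proof.
move=> nx; apply: (nonneg_map (f := fun y => x * y)).
  by move=> c u v; rewrite mulrDr scalerAr.
move=> b Bb; apply: (nonneg_map (f := fun x => x * b)) nx.
  by move=> c u v; rewrite mulrDl scalerAl.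
move=> b' Bb' z; case: (pselect (BB z)) => Bz; first by case: hB => _ + _ _; apply.
by rewrite (coef_notin bB).
Qed.

Lemma nonneg_proj d x : nonneg x -> nonneg (proj hH d x).
Proof.
apply: nonneg_map; first exact: proj_linear.
move=> b [m _ /= bm]; have pb : pc m b by apply: (gB m).1.
case: (eqVneq m d) => [<-|/eqP ne].
  by rewrite proj_id //; apply: nonneg_basis; exists m.
by rewrite (proj_off ne pb); apply: nonneg0.
Qed.

(** A basis element b of degree 0 is its counit times 1, so the coefficient of b in b * b is that
    counit, and products have non-negative coefficients. *)
Lemma counit_nonneg x : nonneg x -> 0 <= eps x.
Proof.
apply: (nonneg_fun (counit_linear hH)) => b [[|m] _ /= bm].
  have pb : pc 0 b by apply: (gB 0%N).1.
  have Bb : BB b by exists 0%N.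
  have := nonnegM (nonneg_basis Bb) (nonneg_basis Bb) b.
  rewrite [in X in X * _](piece0P pb) -scalerAl mul1r.
  by rewrite (linZ (coef_linear b bB)) (coef_basis _ bB Bb) eqxx /GRing.scale /= mulr1.
have pb : pc m.+1 b by apply: (gB m.+1).1.
by rewrite (piece_counit (ltn0Sn m) pb).
Qed.

Lemma eps1_basis b : b \in B 1%N -> eps1 b = 1.
Proof.
move=> b1; rewrite -[LHS]/(sum_coef BB (proj hH 1 b)) proj_id; last exact: (gB 1%N).1.
by apply: (sum_coef_basis bB); exists 1%N.
Qed.

Lemma eps1_nonneg x : nonneg x -> 0 <= (eps1 x : K).
Proof.
apply: (nonneg_fun (eps1_linear gB)) => b [m _ /= bm].
case: (eqVneq m 1%N) => [m1|/eqP ne].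
  by rewrite eps1_basis // -m1.
by rewrite (eps1_off gB _ ne) //; apply: (gB m).1.
Qed.

Lemma comul_basis x : BB x -> exists2 s : seq (K * (H * H)),
  (forall p, p \in s -> [/\ 0 <= p.1, BB p.2.1 & BB p.2.2]) &
  comul hH x = \sum_(p <- s) p.1 *: tens p.2.1 p.2.2.
Proof.
move=> Bx; have bT := tens_basis bB bB.
pose pick q := xget (0, 0) [set p : H * H | [/\ BB p.1, BB p.2 & q = tens p.1 p.2]].
have pickP q : tens_set BB BB q -> [/\ BB (pick q).1, BB (pick q).2
    & q = tens (pick q).1 (pick q).2].
  move=> [b [c [Bb Bc e]]]; rewrite /pick.
  by case: xgetP => [p -> //|/(_ (b, c))]; case.
have := expand_basis (x := comul hH x) bT I; set S := finsupp _ => e.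
have SB q : q \in S -> tens_set BB BB q.
  exact: (expandsP (x := comul hH x) bT I).1.
exists [seq (coef (tens_set BB BB) (comul hH x) q, pick q) | q <- S].
  move=> _ /mapP[q /SB qS ->]; have [B1 B2 eq] := pickP q qS; split => //=.
  by rewrite eq; case: hB => _ _ + _; apply.
rewrite big_map [LHS]e; apply: eq_big_seq => q /SB qS /=.
by have [_ _ <-] := pickP q qS.
Qed.

Lemma tlift_nonneg (h : H -> H -> H) x : is_bilinear h ->
  (forall b c, BB b -> BB c -> nonneg (h b c)) ->
  nonneg x -> nonneg (tlift h (comul hH x)).
Proof.
move=> bh nh; have lh := tlift_linear bh.
apply: (nonneg_map (lin_comp lh (comul_linear hH))) => b Bb.
have [s sP ->] := comul_basis Bb; rewrite (lin_sum lh) big_seq.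
apply: nonneg_sum => p /sP [p0 B1 B2]; rewrite (linZ lh) tlift_tens //.
by apply: nonnegZ => //; apply: nh.
Qed.

Lemma der_nonneg x : nonneg x -> nonneg (der x).
Proof.
apply: tlift_nonneg; first exact: (eps1_bilin gB (@lin_id K H)).
move=> b c Bb Bc; apply: nonnegZ; last exact: nonneg_basis.
by apply: eps1_nonneg; apply: nonneg_basis.
Qed.

Lemma epow_nonneg n x : nonneg x -> 0 <= (epow n x : K).
Proof.
elim: n x => [|n IHn] x nx; first exact: counit_nonneg.
by rewrite epowS; apply: IHn; apply: der_nonneg.
Qed.

Lemma conv_proj_nonneg d s x : nonneg x -> nonneg (conv_proj hH (d :: s) x).
Proof.
elim: s d x => [|d' s IHs] d x nx; first exact: nonneg_proj.
have lp := @proj_linear _ _ hH d; have lc := conv_proj_linear hH d' s.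
rewrite conv_projS conv_tlift //; apply: tlift_nonneg nx.
  exact: (bilin_comp (mul_bilin H) lp lc).
move=> b c Bb Bc; apply: nonnegM; first by apply: nonneg_proj; apply: nonneg_basis.
by apply: IHs; apply: nonneg_basis.
Qed.

(** A term of bidegree (i, j) with i + j = n survives in exactly one summand. *)
Lemma comul_split n x : pc n x -> comul hH x =
  \sum_(i < n.+1) tmap (proj hH i) (proj hH (n - i)) (comul hH x).
Proof.
move=> px; have [s sP ->] := piece_comul px.
have lp := @proj_linear _ _ hH.
under [RHS]eq_bigr => i _ do
  rewrite (lin_sum (tmap_linear (lp i) (lp (n - i)%N))).
rewrite exchange_big; apply: eq_big_seq => p /sP [i [j [ij p1 p2]]] /=.
have li : (i < n.+1)%N by rewrite ltnS -ij leq_addr.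
rewrite (bigD1 (Ordinal li)) //= tmap_tens // !proj_id //; last first.
  by rewrite -ij addKn.
rewrite big1 ?addr0 // => k nk; rewrite tmap_tens // (proj_off _ p1).
  by have := (tens_bilinear H H).1 (proj hH (n - k) p.2) => /lin0.
by move=> e; move/eqP: nk; apply; apply: val_inj.
Qed.

(** Projection to degree 0 is the counit times 1 ([proj0E]), so the counit axiom evaluates this
    extreme bidegree. *)
Lemma comul_bottom n x : pc n x ->
  tmap (proj hH 0) (proj hH n) (comul hH x) = tens 1 x.
Proof.
move=> px; have lp := @proj_linear _ _ hH.
have lr := (tens_bilinear H H).2 1.
rewrite -{2}(proj_id px) -{2}[x](counitl hH).
rewrite (comp_tlift _ _ (lp n)) (comp_tlift _ _ lr); apply: eq_tlift => a b.
rewrite proj0E (linZ (lp n)) (linZ lr).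
by rewrite (linZ ((tens_bilinear H H).1 (proj hH n b))).
Qed.

Lemma comul_top n x : pc n x ->
  tmap (proj hH n) (proj hH 0) (comul hH x) = tens x 1.
Proof.
move=> px; have lp := @proj_linear _ _ hH.
have lr := (tens_bilinear H H).1 1.
rewrite -{2}(proj_id px) -{2}[x](counitr hH).
rewrite (comp_tlift _ _ (lp n)) (comp_tlift _ _ lr); apply: eq_tlift => a b.
rewrite proj0E (linZ (lp n)) (linZ lr).
by rewrite (linZ ((tens_bilinear H H).2 (proj hH n a))).
Qed.

(** Strong induction: above degree 1, non-primitivity supplies a coproduct term with positive
    coefficient and both degrees positive. Its contribution to [epowD] is positive and the others
    are non-negative. *)
Lemma epow_gt0 n x : (0 < n)%N -> x \in B n -> 0 < (epow n x : K).
Proof.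
elim/ltn_ind: n x => n IHn x n0 xn.
case: n n0 IHn xn => [//|[|n]] _ IHn xn; first by rewrite (epow1 gB) eps1_basis.
have px : pc n.+2 x by apply: (gB n.+2).1.
have Bx : BB x by exists n.+2.
have [s sP es] := comul_basis Bx.
have [p [i [ps /andP[i0 iN] p0 p1 p2]]] : exists p i, [/\ p \in s, (0 < i < n.+2)%N,
    0 < p.1, p.2.1 \in B i & p.2.2 \in B (n.+2 - i)%N].
  (* Without such a term only the two extreme bidegrees of [comul_split] survive, and x is
     primitive. *)
  apply: contrapT => nex; case: hB => _ _ _ /(_ n.+2 x isT xn); apply.
  rewrite [LHS](comul_split px) big_ord_recl big_ord_recr /= subn0 subnn.
  rewrite (comul_bottom px) (comul_top px) big1 ?add0r // => i _ /=.
  (* [bump 0 i] is i + 1, so j runs over the interior degrees. *)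
  have lp := @proj_linear _ _ hH; set j := bump 0 i.
  have lt := tmap_linear (lp j) (lp (n.+2 - j)%N).
  rewrite es (lin_sum lt) big1_seq // => p /andP[_ ps].
  have [p0 [k _ /= k1] [l _ /= l2]] := sP _ ps.
  have q1 : pc k p.2.1 by apply: (gB k).1.
  have q2 : pc l p.2.2 by apply: (gB l).1.
  rewrite (linZ lt) tmap_tens //.
  case: (eqVneq k j) => [kj|/eqP kj]; last first.
    rewrite (proj_off kj q1) (lin0 ((tens_bilinear H H).1 _)) scaler0 //.
  case: (eqVneq l (n.+2 - j)%N) => [lj|/eqP lj]; last first.
    rewrite (proj_off lj q2) (lin0 ((tens_bilinear H H).2 _)) scaler0 //.
  case: (eqVneq p.1 0) => [->|pn]; first by rewrite scale0r.
  case: nex; exists p, j; split => //; [|by rewrite lt_def pn|by rewrite -kj|by rewrite -lj].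
  by rewrite /j /bump /= add1n ltnS ltn_ord.
have e := epow_linear gB.
have nn k y : BB y -> 0 <= (epow k y : K).
  by move=> By; apply: epow_nonneg; apply: nonneg_basis.
have bh : is_bilinear (fun a b => (epow i a : K^o) *: epow (n.+2 - i) b).
  exact: (bilin_comp (@scale_bilin K K^o) (e _) (e _)).
rewrite -(subnKC (ltnW iN)) -(epowD gB) es (lin_sum (tlift_linear bh)).
rewrite (perm_big _ (perm_to_rem ps)) big_cons.
apply: ltr_pwDl.
  rewrite (linZ (tlift_linear bh)) tlift_tens //.
  apply: mulr_gt0 => //; apply: mulr_gt0; apply: IHn => //.
  - by rewrite ltn_subrL i0.
  - by rewrite subn_gt0.
rewrite big_seq; apply: sumr_ge0 => q /mem_rem /sP [q0 q1 q2].
rewrite (linZ (tlift_linear bh)) tlift_tens //.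
by apply: mulr_ge0 => //; apply: mulr_ge0; apply: nn.
Qed.

Context (n a : nat) (alpha : a.-tuple 'I_n.+1 -> K).
Context (a_gt0 : (0 < a)%N) (halpha : nonneg_coeffs alpha).

Lemma Psi_nonneg x : nonneg x -> nonneg (Psi alpha hH x).
Proof.
move=> nx; apply: nonneg_sum => D wD; apply: nonnegZ; first exact: halpha.1.
by have [d [s [-> _ _]]] := weak_comp_cons a_gt0 wD; apply: conv_proj_nonneg.
Qed.

(** A weak composition of 0 with at least one part has a part equal to n, which the distinguished
    composition forbids. *)
Lemma nonneg_coeffs_gt0 : (0 < n)%N.
Proof.
have [D [wD nD _]] := halpha.2; case: n D wD nD => // D wD nD.
have [d [s [e _ _]]] := weak_comp_cons a_gt0 wD.
have : d \in [seq (d : nat) | d : 'I_1 <- D] by rewrite e mem_head.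
by move=> /mapP[k kD _]; case: (nD _ kD); rewrite (ord1 k).
Qed.

Lemma beta_gt0 : 0 < beta alpha.
Proof.
have [a0 [D [wD _ aD]]] := halpha.
rewrite /beta (bigD1 D) //= ltr_pwDl //.
  rewrite mulr_gt0 // ltr0n; have [d [s [_ e ->]]] := weak_comp_cons a_gt0 wD.
  have := fact_gt0 n; rewrite -e -[(d + _)%N]/(sumn (d :: s)) multi_fact.
  by rewrite muln_gt0 => /andP[].
by apply: sumr_ge0 => D' /andP[wD' _]; rewrite mulr_ge0 // a0.
Qed.

Lemma trans_ge0 x y : x \in B n -> y \in B n -> 0 <= trans alpha hH B x y.
Proof.
move=> xn yn; have n0 := nonneg_coeffs_gt0.
have b0 := beta_gt0; have ex := epow_gt0 n0 xn; have ey := epow_gt0 n0 yn.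
rewrite /trans !(etaE gB) //; apply: mulr_ge0.
  by apply: divr_ge0; [exact: ltW|apply: mulr_ge0; exact: ltW].
by apply: Psi_nonneg; apply: nonneg_basis; exists n.
Qed.

End Positivity.

(** * Compatibility of eta, Psi and the kernels with theta *)

Section Morphisms.
Context (K : fieldType) (H Hbar : algType K).
Context (hH : graded_connected_hopf H) (hHbar : graded_connected_hopf Hbar).
Context (B : nat -> {fset H}) (Bbar : nat -> {fset Hbar}).
Context (gB : graded_basis hH B) (gBbar : graded_basis hHbar Bbar).
Context (theta : {lrmorphism H -> Hbar}) (htheta : hopf_morphism hH hHbar theta).
Context (thetaB : forall m, theta @` [set` B m] = [set` Bbar m]).

Let lth : linear theta. Proof. exact: linearP. Qed.
Let bB := BB_basis gB.
Let bBbar := BB_basis gBbar.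

Lemma theta_basis m b : b \in B m -> theta b \in Bbar m.
Proof. by move=> bm; have : [set` Bbar m] (theta b) by rewrite -thetaB; exists b. Qed.

Lemma theta_piece m x : piece hH m x -> piece hHbar m (theta x).
Proof.
move=> px; rewrite (piece_expand gB px) (lin_sum lth) big_seq.
apply: piece_sum => b bm; rewrite (linZ lth); apply: pieceZ.
by apply: (gBbar m).1; apply: theta_basis.
Qed.

Lemma theta_proj m x : theta (proj hH m x) = proj hHbar m (theta x).
Proof.
have lp := @proj_linear _ _ hH m; have lp' := @proj_linear _ _ hHbar m.
move: x; apply: (grading_ext (G := hH) (lin_comp lth lp) (lin_comp lp' lth)).
move=> i x px; have px' := theta_piece px.
case: (eqVneq i m) => [<-|/eqP ne]; first by rewrite !proj_id.
by rewrite (proj_off ne px) (proj_off ne px') (lin0 lth).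
Qed.

(** Basis elements go to basis elements, of coefficient sum 1; coefficients of elements identified
    by theta simply add. *)
Lemma sum_coef_theta x :
  sum_coef (total_basis Bbar) (theta x) = sum_coef (total_basis B) x.
Proof.
have l1 := lin_comp (sum_coef_linear bBbar) lth.
move: x; apply: (basis_ext bB l1 (sum_coef_linear bB)) => b /set_mem Bb.
rewrite (sum_coef_basis bB Bb) (sum_coef_basis bBbar) //.
by case: Bb => m _ bm; exists m => //; apply: theta_basis.
Qed.

Lemma theta_der x : der hHbar Bbar (theta x) = theta (der hH B x).
Proof.
rewrite /der htheta.1 tlift_tmap //; last exact: (eps1_bilin gBbar (@lin_id K Hbar)).
rewrite (comp_tlift _ _ lth); apply: eq_tlift => u v.
by rewrite (linZ lth) /eps1 -theta_proj sum_coef_theta.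
Qed.

Lemma epow_theta m x : epow hHbar Bbar m (theta x) = epow hH B m x.
Proof.
elim: m x => [|m IHm] x; first by rewrite /epow /= htheta.2.
by rewrite !epowS theta_der IHm.
Qed.

Lemma theta_conv_proj d s x :
  theta (conv_proj hH (d :: s) x) = conv_proj hHbar (d :: s) (theta x).
Proof.
elim: s d x => [|d' s IHs] d x; first exact: theta_proj.
rewrite !conv_projS !conv_tlift; try exact: proj_linear; try exact: conv_proj_linear.
have bl := bilin_comp (mul_bilin Hbar) (@proj_linear _ _ hHbar d)
  (conv_proj_linear hHbar d' s).
rewrite htheta.1 tlift_tmap // (comp_tlift _ _ lth); apply: eq_tlift => u v.
by rewrite rmorphM /= theta_proj IHs.
Qed.

Context (n a : nat) (alpha : a.-tuple 'I_n.+1 -> K).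
Context (a_gt0 : (0 < a)%N) (n_gt0 : (0 < n)%N).

Lemma theta_Psi x : theta (Psi alpha hH x) = Psi alpha hHbar (theta x).
Proof.
rewrite /Psi (lin_sum lth); apply: eq_bigr => D wD.
have [d [s [-> _ _]]] := weak_comp_cons a_gt0 wD.
by rewrite (linZ lth) theta_conv_proj.
Qed.

Lemma coef_theta x y : piece hH n x ->
  coef (total_basis Bbar) (theta x) y =
  \sum_(b <- B n | theta b == y) coef (total_basis B) x b.
Proof.
move=> px; have lc := coef_linear y bBbar.
rewrite [in LHS](piece_expand gB px) (lin_sum lth) (lin_sum lc).
rewrite [RHS]big_mkcond; apply: eq_big_seq => b bn.
rewrite (linZ lth) (linZ lc) (coef_basis _ bBbar) 1?eq_sym.
  by case: eqP => _; rewrite /GRing.scale /= ?mulr1 ?mulr0.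
by exists n => //; apply: theta_basis.
Qed.

(** eta is constant on the fibres of theta ([epow_theta]), so it factors out of the sum, which
    [coef_theta] then evaluates. *)
Lemma trans_theta x y :
  \sum_(b <- B n | theta b == y) trans alpha hH B x b =
  trans alpha hHbar Bbar (theta x) y.
Proof.
rewrite /trans -theta_Psi coef_theta; last exact: Psi_piece.
rewrite [RHS]mulr_sumr; apply: eq_bigr => b /eqP <-.
by rewrite !(etaE gB) // !(etaE gBbar) // !epow_theta.
Qed.

End Morphisms.

(** * Lumping of Markov chains on finite state sets *)

Section Lumping.
Context (R : realType) (S S' : choiceType) (f : S -> S').
Context (A : {fset S}) (A' : {fset S'}) (p : S -> S -> R) (p' : S' -> S' -> R).
Context (f_im : forall x, x \in A -> f x \in A').
Context (lump : forall x y, x \in A -> y \in A' ->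
  \sum_(z <- A | f z == y) p x z = p' (f x) y).
Context (d : measure_display) (T : measurableType d) (P : probability T R).

Section Process.
Context (X : nat -> T -> S).
Context (XA : forall t w, X t w \in A).
Context (Xm : forall t x, measurable (X t @^-1` [set x])).

Let pr (E : set T) : R := fine (P E).

Lemma pr_total E t : measurable E ->
  pr E = \sum_(x <- A) pr (E `&` X t @^-1` [set x]).
Proof.
move=> mE; have m x : measurable (E `&` X t @^-1` [set x]) by apply: measurableI.
rewrite /pr sum_fine => [|x _]; last exact: fin_num_measure.
congr fine; rewrite -measure_fbigsetU //.
  congr (P _); rewrite -bigcup_fset; apply/seteqP; split=> [w Ew|w [x _ []//]].
  by exists (X t w) => //=; apply: XA.
by move=> x y _ _ [w [[_ /= <-] [_ /= <-]]].
Qed.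

Lemma measurable_lump t y : measurable ((f \o X t) @^-1` [set y]).
Proof.
rewrite (_ : _ @^-1` _ =
    \big[setU/set0]_(x <- A | f x == y) X t @^-1` [set x]).
  exact: bigsetU_measurable.
rewrite -bigcup_seq_cond; apply/seteqP; split=> [w /= e|w [x /= /andP[_ /eqP <-] ->]]//.
by exists (X t w) => //=; rewrite XA e eqxx.
Qed.

(* Interpolates between the past of X (k = t + 1) and that of f o X (k = 0);  *)
(* the lumped Markov property is transported by downward induction on k.      *)
Definition mixed_past (t k : nat) (u : nat -> S) (s : nat -> S') : set T :=
  [set w | forall i, (i <= t)%N -> if (i < k)%N then X i w = u i else f (X i w) = s i].

Lemma mixed_past_measurable t k u s : measurable (mixed_past t k u s).
Proof.
rewrite (_ : mixed_past _ _ _ _ = \bigcap_(i in [set i | (i <= t)%N])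
   (if (i < k)%N then X i @^-1` [set u i] else (f \o X i) @^-1` [set s i])).
  apply: bigcap_measurable => [|i _]; first by exists 0%N.
  by case: ifP => _ //; apply: measurable_lump.
apply/seteqP; split=> w h i /= it; have := h i it; by case: ifP.
Qed.

End Process.

(** Given the full past of X, the law of the next image depends only on the current image, by
    [lump]; averaging over all pasts with the same image preserves this law. *)
Lemma markov_chain_lump (x0 : S) (X : nat -> T -> S) : x0 \in A ->
  markov_chain P A p x0 X ->
  markov_chain P A' p' (f x0) (fun t w => f (X t w)).
Proof.
move=> x0A [XA Xm X0 Xp]; have ml := measurable_lump XA Xm.
split=> [t w|t x||t s sA' /=]; first exact: f_im; first exact: ml.
  apply/eqP; rewrite eq_le probability_le1 //=; last exact: ml.
  rewrite -X0; apply: le_measure; rewrite ?inE //; first exact: ml.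
  by move=> w /= ->.
set F := (fun w => f (X t.+1 w)) @^-1` [set s t.+1].
have mF : measurable F by apply: ml.
pose pr (E : set T) : R := fine (P E).
have mM := mixed_past_measurable XA Xm.
have prT := pr_total XA Xm.
(* In product form the identity makes sense for null pasts and is additive in the past; j counts the
   times at which only the image is prescribed. *)
suff main : forall j k u, (k + j)%N = t.+1 -> (forall i, u i \in A) ->
    (forall i, (i < k)%N -> f (u i) = s i) ->
    pr (F `&` mixed_past X t k u s) =
    p' (s t) (s t.+1) * pr (mixed_past X t k u s).
  move=> P0; rewrite /cond_prob; apply: (canLR (mulfK _)).
    rewrite fine_eq0; first exact/eqP.
    exact: fin_num_measure (mM t 0%N (fun=> x0) s).
  by apply: (main t.+1 0%N (fun=> x0)).
elim=> [|j IHj] k u kj uA us.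
  have {kj}kt : k = t.+1 by rewrite -kj addn0.
  rewrite {}kt in us *; set E := mixed_past X t t.+1 u s.
  have mE : measurable E by apply: mM.
  rewrite -us // -lump // mulr_suml [LHS](prT _ t.+1); last exact: measurableI.
  rewrite [RHS]big_mkcond; apply: eq_big_seq => y yA.
  case: eqP => [fy|nfy]; last first.
    rewrite -[RHS](@fine0 R) -(measure0 P); congr (fine (P _)).
    by apply/seteqP; split=> // w [[Fw _] /= e]; apply: nfy; rewrite -e.
  rewrite (_ : F `&` E `&` _ = X t.+1 @^-1` [set y] `&` E); last first.
    apply/seteqP; split=> w; first by case=> -[].
    by case=> /= e Ew; split=> //; split=> //; rewrite /F /= e.
  (* The prescribed path extended by y at time t + 1, as the Markov property of X requires. *)
  pose v i := if i == t.+1 then y else u i.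
  have vE i : (i <= t)%N -> v i = u i.
    by rewrite /v => it; case: eqP => // e; rewrite e ltnn in it.
  have vS : v t.+1 = y by rewrite /v eqxx.
  have pastE : [set w | forall i, (i <= t)%N -> X i w = v i] = E.
    apply/seteqP; split=> w h i it; first by rewrite ltnS it -vE // h.
    by have := h i it; rewrite ltnS it vE.
  (* The Markov property is silent on a null past, but there both sides vanish. *)
  case: (eqVneq (P E) 0%E) => [E0|/eqP En].
    rewrite /pr E0 mulr0; suff -> : P (X t.+1 @^-1` [set y] `&` E) = 0%E by [].
    by apply: subset_measure0 E0 => //; apply: measurableI.
  have := Xp t v; rewrite pastE /cond_prob vS (vE t) // => <- //.
    rewrite divfK // fine_eq0; first exact/eqP.
    exact: fin_num_measure.
  by move=> i; rewrite /v; case: ifP.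
have kt : (k <= t)%N by rewrite -ltnS -kj addnS ltnS leq_addr.
set E := mixed_past X t k u s.
have mE : measurable E by apply: mM.
(* Split by the value of X at time k: states outside the fibre over [s k] contribute nothing, and
   each remaining one prescribes one more time, giving the case k + 1. *)
rewrite /pr (prT _ k mE) (prT (F `&` E) k) ?mulr_sumr; last exact: measurableI.
apply: eq_big_seq => x xA.
case: (eqVneq (f x) (s k)) => [fx|/eqP nfx]; last first.
  suff E0 : E `&` X k @^-1` [set x] = set0.
    by rewrite -setIA E0 setI0 measure0 /= mulr0.
  apply/seteqP; split=> // w [Ew /= e]; apply: nfx; rewrite -e.
  by have := Ew k kt; rewrite ltnn.
pose v i := if i == k then x else u i.
have EE : E `&` X k @^-1` [set x] = mixed_past X t k.+1 v s.
  apply/seteqP; split=> w.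
    case=> Ew /= e i it; have := Ew i it; rewrite ltnS [(i <= k)%N]leq_eqVlt /v.
    by case: eqP => [->|_] //=; rewrite ltnn.
  move=> h; split; last by have := h k kt; rewrite ltnS leqnn /v eqxx.
  move=> i it; have := h i it; rewrite ltnS [(i <= k)%N]leq_eqVlt /v.
  by case: eqP => [->|_] //=; rewrite ltnn => ->.
rewrite -setIA EE; apply: IHj; first by rewrite addSnnS.
  by move=> i; rewrite /v; case: ifP.
move=> i; rewrite ltnS leq_eqVlt /v; case: eqP => [->//|_] /=; exact: us.
Qed.

End Lumping.

(* The ground field K is an ordered subfield of R, through iota: K = rat with
   iota = ratr, or K = R with iota the identity. *)
Theorem theorem4p1 (R : realType) (K : realFieldType)
    (iota : {rmorphism K -> R}) (iota_le : {homo iota : x y / x <= y})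
    (H Hbar : algType K)
    (hH : graded_connected_hopf H) (hHbar : graded_connected_hopf Hbar)
    (B : nat -> {fset H}) (Bbar : nat -> {fset Hbar})
    (hB : state_space_basis hH B) (hBbar : graded_basis hHbar Bbar)
    (theta : {lrmorphism H -> Hbar}) (htheta : hopf_morphism hH hHbar theta)
    (thetaB : forall m, theta @` [set` B m] = [set` Bbar m])
    (n a : nat) (ha : (2 <= a)%N) (alpha : a.-tuple 'I_n.+1 -> K)
    (halpha : nonneg_coeffs alpha) :
  let Ker x y := iota (trans alpha hH B x y) in
  let Kerbar x y := iota (trans alpha hHbar Bbar x y) in
  stochastic (Bbar n) Kerbar /\
  forall (d : measure_display) (T : measurableType d) (P : probability T R)
    (x0 : H) (X : nat -> T -> H),
    x0 \in B n ->
    markov_chain P (B n) Ker x0 X ->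
    markov_chain P (Bbar n) Kerbar (theta x0) (fun t w => theta (X t w)).
Proof.
move=> Ker Kerbar.
have gB : graded_basis hH B by case: hB.
have a0 : (0 < a)%N := ltnW ha.
have n0 := nonneg_coeffs_gt0 a0 halpha.
have lump x y : \sum_(z <- B n | theta z == y) Ker x z = Kerbar (theta x) y.
  by rewrite /Kerbar -(trans_theta gB hBbar htheta thetaB alpha a0 n0) rmorph_sum.
have surj y : y \in Bbar n -> exists2 x, x \in B n & theta x = y.
  move=> yB; have : [set` Bbar n] y by [].
  by rewrite -thetaB => -[x xB <-]; exists x.
split; last first.
  move=> d T P x0 X x0B; apply: markov_chain_lump => //.
  by move=> x; apply: theta_basis.
(* Every state of the image chain lifts to B n, so its entries are fibre sums of non-negative
   entries. *)
split=> [_ y /surj[x xB <-] yB|_ /surj[x xB <-]].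
  rewrite -lump big_seq_cond; apply: sumr_ge0 => z /andP[zB _].
  rewrite /Ker -(rmorph0 iota); apply: iota_le.
  exact: (trans_ge0 hB).
rewrite -(rmorph_sum iota) (trans_row_sum hBbar) ?rmorph1 //.
(* The normalising factor is nonzero because eta at [theta x] equals eta at x, which is positive. *)
rewrite (etaE hBbar) // (epow_theta gB hBbar htheta thetaB).
by rewrite gt_eqF // mulr_gt0 ?(beta_gt0 a0 halpha) // (epow_gt0 hB).
Qed.
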